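(* Let $L$ be a non-contractible compact metric ANR. Suppose that $X$ and $Y$ are non-empty compact spaces, and $X$ is Fréchet. If $L\text{-}\mathrm{Ind}\,X=L\text{-}\mathrm{Ind}\,Y$ and $L\text{-}\mathrm{Ind}\,K(X)\geq 1$, then $$L\text{-}\mathrm{Ind}\,Z(X,Y)=L\text{-}\mathrm{Ind}\,X+1.$$
   Context: All spaces are $T_1$ and completely regular (so compact spaces are Hausdorff); maps are continuous. A space is Fréchet if, whenever $x\in\mathrm{cl}\,A$, some sequence in $A$ converges to $x$. $L$ is a non-empty compact metric ANR. $L\text{-}\mathrm{Ind}$ (normal $X$; values: ordinals, $-1$, $\infty$): $L\text{-}\mathrm{Ind}\,X=-1$ iff $X=\emptyset$; for an ordinal $\alpha$, $L\text{-}\mathrm{Ind}\,X\le\alpha$ iff for every map $f\colon F\to L$ from a closed $F\subset X$ there is an open $U\supset F$ such that $f$ extends to a map $U\to L$ and $L\text{-}\mathrm{Ind}(X\setminus U)<\alpha$; for $X\neq\emptyset$ the value is the least such ordinal $\alpha$, or $\infty$ if none. Conventions: $\infty$ is bigger than every ordinal, and $\infty+1=\infty$. For a normal space $X$ and $b\in X$, $L\text{-}\mathrm{Ind}_{b+}X=\min\{\alpha:\text{ there is a neighbourhood }U\text{ of }b\text{ with }L\text{-}\mathrm{Ind}\,\mathrm{cl}\,U\le\alpha\}$ (possibly $\infty$), and $K(X)=\{b\in X: L\text{-}\mathrm{Ind}_{b+}X=L\text{-}\mathrm{Ind}\,X\}$, a closed subset of $X$. The space $Z(X,Y)$ for non-empty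 compact $X,Y$. $A_{\mathfrak m}$ is the one-point compactification of the discrete space of cardinality $\mathfrak m$, and $\mu$ is its unique non-isolated point. $\mathcal S_X$ is the family of all subsets of $X$ that are finite (possibly empty) or homeomorphic to $A_{\aleph_0}$. Fix a cardinal $\mathfrak m\ge\max\{\aleph_0,(wX)^+,(wY)^+,\mathrm{card}\,\mathcal S_X\}$ ($w$ = weight) and a function $\varphi\colon A_{\mathfrak m}\setminus\{\mu\}\to\mathcal S_X$ with $\mathrm{card}\,\varphi^{-1}(S)=\mathfrak m$ for every $S\in\mathcal S_X$. Let $\pi_1\colon A_{\mathfrak m}\times X\times Y\to N$ be the quotient map collapsing each set $\{\mu\}\times\{x\}\times Y$, $x\in X$, to a point. Put $H(\mu)=\pi_1(\{\mu\}\times X\times Y)$, $H(\alpha)=\pi_1(\{\alpha\}\times\varphi(\alpha)\times Y)$ for $\alpha\ne\mu$, and $Z(X,Y)=\bigcup_{\alpha\in A_{\mathfrak m}}H(\alpha)\subset N$. The choices of $\mathfrak m$ and $\varphi$ are arbitrary. *)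

(* Defs.v *)
From HB Require Import structures.
From mathcomp Require Import all_boot all_order all_algebra.
From mathcomp Require Import all_classical all_reals all_analysis.

Set Implicit Arguments.
Unset Strict Implicit.
Unset Printing Implicit Defensive.

Import Order.TTheory GRing.Theory Num.Theory.
Import numFieldNormedType.Exports.

Local Open Scope classical_set_scope.
Local Open Scope ring_scope.
Local Open Scope card_scope.

(* Ordinals as well-founded trees: [osup f] denotes the least ordinal that is
   strictly greater than every [f i].  Several trees denote the same ordinal, so
   ordinals are compared with [ord_le] and are equal when [ord_le] holds in both
   directions.  [Ord] lives one universe above its index types; wrapping it in
   [set] or in a canonical structure would bring it back to the level of the
   topological spaces and cause universe inconsistencies, which is why the
   predicates on it below are bare functions to [Prop]. *)
Inductive Ord : Type := osup (A : Type) (f : A -> Ord).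

(* sup (f i + 1) <= sup (g j + 1) iff every f i is <= some g j. *)
Fixpoint ord_le (a b : Ord) {struct a} : Prop :=
  let: osup A f := a in let: osup B g := b in
  forall i : A, exists j : B, ord_le (f i) (g j).

Definition ord_lt (a b : Ord) : Prop :=
  let: osup B g := b in exists j : B, ord_le a (g j).

Definition ozero : Ord := osup (fun e : Empty_set => match e with end).
Definition osucc (a : Ord) : Ord := osup (fun _ : unit => a).

Definition ord_is_least (P : Ord -> Prop) (a : Ord) : Prop :=
  P a /\ forall b, P b -> ord_le a b.

Lemma ord_le_trans a b c : ord_le a b -> ord_le b c -> ord_le a c.
Proof.
elim: a b c => I f IH [J g] [K h] /= ab bc i.
have [j ij] := ab i; have [k jk] := bc j.
by exists k; exact: IH ij jk.
Qed.

Lemma ord_ltNge a b : ~ ord_le a b -> ord_lt b a.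
Proof.
elim: a b => I f IH [J g] /= /existsNP[i /forallNP fg].
by exists i; case: (f i) (IH i) fg => K h IHi fg j; exact: IHi (fg j).
Qed.

Lemma ord_least_ex (P : Ord -> Prop) :
  (exists a, P a) -> exists a, ord_is_least P a.
Proof.
move=> [a0 Pa0]; apply: contrapT => noleast.
suff H a b : ord_le b a -> ~ P b.
  apply: (H a0 a0) Pa0; elim: {noleast H} a0 => I f IH /= i.
  by exists i; exact: IH.
elim: a b => I f IH b ba Pb; apply: noleast; exists b; split => // c Pc.
apply: contrapT => /ord_ltNge cb.
case: b cb ba {Pb} => J g /= [j cj] ba; have [i ji] := ba j.
exact: IH (ord_le_trans cj ji) Pc.
Qed.

(* The values of L-Ind; they are compared with [dim_le] and [dim_eq], the latter
   being equality of the ordinals denoted. *)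
Inductive Dim : Type := DimN1 | DimOrd (a : Ord) | DimInfty.

Definition dim_le (d e : Dim) : Prop :=
  match d, e with
  | DimN1, _ | _, DimInfty => True
  | DimOrd a, DimOrd b => ord_le a b
  | _, _ => False
  end.

Definition dim_eq (d e : Dim) : Prop := dim_le d e /\ dim_le e d.

Definition dim_succ (d : Dim) : Dim :=
  match d with
  | DimN1 => DimOrd ozero
  | DimOrd a => DimOrd (osucc a)
  | DimInfty => DimInfty
  end.

Definition dim_min (P : Ord -> Prop) : Dim :=
  match pselect (exists a, P a) with
  | left exP => DimOrd (projT1 (cid (ord_least_ex exP)))
  | right _ => DimInfty
  end.

Section LInd.
Variable L : topologicalType.

(* L-Ind X <= a.  The clause L-Ind (X \ U) < osup h is unfolded: the value is -1
   (empty remainder) or it is at most some [h j].  Since L is non-empty, maps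
   from a subset of X to L are rendered by total functions continuous within
   that subset. *)
Fixpoint LInd_le (a : Ord) (X : topologicalType) {struct a} : Prop :=
  let: osup J h := a in
  forall (F : set X) (f : X -> L), closed F -> {within F, continuous f} ->
  exists U : set X,
    [/\ open U, F `<=` U,
        exists g : X -> L,
          {within U, continuous g} /\ (forall x, F x -> g x = f x) &
        ~` U = set0 \/ exists j : J, LInd_le (h j) (set_type (~` U))].

Definition LInd (X : topologicalType) : Dim :=
  if pselect ([set: X] = set0) then DimN1 else dim_min (LInd_le^~ X).

Definition LInd_at (X : topologicalType) (b : X) : Dim :=
  dim_min (fun a => exists U : set X,
    nbhs b U /\ dim_le (LInd (set_type (closure U))) (DimOrd a)).

Definition LInd_kernel (X : topologicalType) : set X :=
  [set b | dim_eq (LInd_at b) (LInd X)].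

End LInd.
Arguments LInd_kernel : clear implicits.

Definition tychonoff_space (X : topologicalType) : Prop :=
  accessible_space X /\ completely_regular_space X.

Definition frechet_space (X : topologicalType) : Prop :=
  forall (A : set X) (x : X), closure A x ->
  exists u : nat -> X, (forall n, A (u n)) /\ u @ \oo --> x.

Definition homeomorphic (X Y : topologicalType) : Prop :=
  exists (f : X -> Y) (g : Y -> X),
    [/\ continuous f, continuous g, cancel f g & cancel g f].

Definition contractible (R : realType) (X : topologicalType) : Prop :=
  exists (x0 : X) (H : X * R -> X),
    [/\ {within [set: X] `*` [set t : R | 0 <= t <= 1], continuous H},
        forall x, H (x, 0) = x & forall x, H (x, 1) = x0].

Definition neighbourhood_retract (M : topologicalType) (A : set M) : Prop :=
  exists (U : set M) (r : M -> M),
    [/\ open U, A `<=` U, {within U, continuous r}, r @` U `<=` A &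
        forall x, A x -> r x = x].

(* Absolute neighbourhood retract for the class of metric spaces. *)
Definition ANR (R : realType) (X : topologicalType) : Prop :=
  forall (M : metricType R) (A : set M),
    closed A -> homeomorphic X (set_type A) -> neighbourhood_retract A.

Definition card_lt (T U : Type) (A : set T) (B : set U) : Prop :=
  (A #<= B) /\ ~ (B #<= A).

(* The cardinality of B is the weight of X. *)
Definition weight_basis (X : topologicalType) (B : set (set X)) : Prop :=
  basis B /\ forall B' : set (set X), basis B' -> B #<= B'.

(* A_m, for m the cardinality of M; the point mu is [None]. *)
Definition Aone (M : choiceType) : topologicalType :=
  one_point_compactification (discrete_topology M).

Definition seq_family (X : topologicalType) : set (set X) :=
  [set S | finite_set S \/ homeomorphic (set_type S) (Aone nat)].
Arguments seq_family : clear implicits.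

(* The conditions on m = card M and on phi, whose domain is A_m minus mu = M.
   By definition of cardinal successors, (wX)^+ <= m means wX < m. *)
Definition Z_data (X Y : topologicalType) (M : choiceType) (phi : M -> set X)
    : Prop :=
  [/\ [set: nat] #<= [set: M],
      exists2 B : set (set X), weight_basis B & card_lt B [set: M],
      exists2 B : set (set Y), weight_basis B & card_lt B [set: M],
      seq_family X #<= [set: M] &
      (forall m, seq_family X (phi m)) /\
      (forall S, seq_family X S -> phi @^-1` [set S] #= [set: M])].

Section Zspace.
Local Open Scope quotient_scope.
Variables (X Y : topologicalType) (M : choiceType).

Definition collapse_rel : rel (Aone M * X * Y) := fun p q =>
  `[< p = q \/ [/\ p.1.1 = None, q.1.1 = None & p.1.2 = q.1.2] >].

Lemma collapse_refl : reflexive collapse_rel.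
Proof. by move=> p; apply/asboolP; left. Qed.

Lemma collapse_sym : symmetric collapse_rel.
Proof.
by move=> p q; apply/asboolP/asboolP => -[->|[? ? ?]]; by [left|right].
Qed.

Lemma collapse_trans : transitive collapse_rel.
Proof.
move=> q p r /asboolP[->//|[p0 q0 pq]] /asboolP[<-|[_ r0 qr]]; apply/asboolP;
  by right; split; rewrite // pq.
Qed.

Definition collapse_equiv : equiv_rel (Aone M * X * Y) :=
  EquivRel collapse_rel collapse_refl collapse_sym collapse_trans.

Definition Nspace : topologicalType :=
  quotient_topology {eq_quot collapse_equiv}.

Definition pi1 : Aone M * X * Y -> Nspace := \pi_Nspace.

Variable phi : M -> set X.

Definition Zfiber (a : Aone M) : set Nspace :=
  pi1 @` ([set a] `*` (if a is Some m then phi m else [set: X]) `*` [set: Y]).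

Definition Zspace : topologicalType := set_type (\bigcup_a Zfiber a).

End Zspace.

(* Main.v *)
Require Import Defs.
From HB Require Import structures.
From mathcomp Require Import all_boot all_order all_algebra.
From mathcomp Require Import all_classical all_reals all_analysis.
From mathcomp Require Import ring lra.

(** Write [b] for L-Ind X = L-Ind Y, and let [Z] be the space Z(X, Y).  It
    projects onto the one-point compactification (the index) and onto [X]; the
    fibre over the point at infinity is a copy of [X], called the base, and the
    fibre over any other index [m] is [phi m * Y], where [phi m] is finite or a
    convergent sequence.

    Upper bound (lemma [Zspace_LInd_le]).  Let [f] map a closed set [F] to [L].
    On the base [f] extends to an open set [U0] whose complement has smaller
    dimension.  As [L] is an ANR, this extension can be pushed to the other
    fibres along the projection to [X] and deformed there so that it still
    agrees with [f], for all but finitely many [m] (lemma [retract_extension]).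
    In such a fibre each point of [phi m] other than the limit [b_m] is
    isolated, so an arbitrary constant can be used over the points of [phi m]
    outside [U0], except over [b_m].  Hence the part [C] of [Z] where [f] stays
    unextended meets almost every fibre in a subset of [{b_m} * Y].  Such a [C]
    has L-Ind at most [b]: for a second map, the fibres lying over the new open
    set of [X] are covered by the extension from the base, and in the other ones
    nothing is prescribed (lemma [LInd_le_flat]).  The finitely many exceptional
    fibres are harmless since L-Ind (phi m * Y) is at most [b] (lemma
    [LInd_le_prod]).

    Lower bound (lemma [Zspace_not_LInd_le]).  If [b] is infinite, it suffices
    that [Z] contains a copy of [X].  Otherwise, as L-Ind K(X) > 0, some map
    [f] from a closed subset of K(X) to [L] does not extend over K(X).  Suppose
    that [f], seen on the base, extends to [g] on an open set [U] of [Z] with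
    L-Ind (Z \ U) < b, and let [U0] be the trace of [U] on the base.  Then
    K(X) lies in the closure of [U0], since otherwise Z \ U would contain a
    closed neighbourhood in [X] of a point of K(X), and this has L-Ind equal to
    [b].  Moreover [g] has a limit along [U0] at each point [x] of K(X)
    (lemma [Zspace_limit]).  Otherwise, [X] being Frechet, two sequences of
    [U0] converge to [x] while the values of [g] on them stay apart.  Together
    with [x] they form a set [S] which is [phi m] for uncountably many [m], and
    for all but countably many of these [U] contains the part of the fibre over
    the sequences and [g] is there close to its values on the base.  By
    continuity [U] misses [{x} * Y] in such a fibre, so L-Ind (Z \ U) would be
    at least L-Ind Y = b.  The limits extend [g], hence [f], over K(X), which is
    a contradiction. *)

Set Implicit Arguments.
Unset Strict Implicit.
Unset Printing Implicit Defensive.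

Import Order.TTheory GRing.Theory Num.Theory.
Import numFieldNormedType.Exports.
Import metricType_numDomainType.

Local Open Scope classical_set_scope.
Local Open Scope ring_scope.

(** * Ordinals, subspaces and the monotonicity of L-Ind *)

Lemma ord_le_refl a : ord_le a a.
Proof. by elim: a => I f IH /= i; exists i. Qed.

Lemma ord_lt_irrefl a : ~ ord_lt a a.
Proof.
elim: a => I f IH /= [i] h.
apply: (IH i); case E: (f i) h => [J g] /= h.
by have [j] := h i; rewrite E => ?; exists j.
Qed.

Lemma ord_lt_le a b : ord_lt a b -> ord_le a b.
Proof.
elim: a b => I f IH [J g] /= [j] h i; exists j.
by apply: IH; case: (g j) h => K k /= h; exact: h.
Qed.

Lemma ord_le_total a b : ord_le a b \/ ord_le b a.
Proof.
have [?|/ord_ltNge/ord_lt_le ?] := pselect (ord_le a b); by [left|right].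
Qed.

Lemma within_continuousP (T U : topologicalType) (A : set T) (f : T -> U) :
  {within A, continuous f} <->
  forall x, A x -> forall O : set U, open O -> O (f x) ->
    exists V : set T, [/\ open V, V x & forall z, V z -> A z -> O (f z)].
Proof.
split=> [/subspace_continuousP cf x Ax O oO Ofx|H].
  have := cf x Ax O (open_nbhs_nbhs (conj oO Ofx)).
  rewrite nbhs_simpl /within /= nbhsE => -[V [oV Vx] VO].
  by exists V; split.
apply/subspace_continuousP => x Ax O.
rewrite nbhsE => -[P [oO Px] PO].
have [V [oV Vx VO]] := H x Ax P oO Px.
rewrite nbhs_simpl /within /=.
apply: filterS (open_nbhs_nbhs (conj oV Vx)) => z Vz Az.
exact/PO/VO.
Qed.

Lemma continuous_openP (T U : topologicalType) (f : T -> U) :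
  continuous f <->
  forall x, forall O : set U, open O -> O (f x) ->
    exists V : set T, [/\ open V, V x & forall z, V z -> O (f z)].
Proof.
split=> [cf x O oO Ofx|H].
  by exists (f @^-1` O); split => //; move/continuousP: cf; exact.
move=> x O; rewrite nbhsE => -[P [oO Px] PO].
have [V [oV Vx VO]] := H x P oO Px.
rewrite nbhs_simpl /=.
by apply: filterS (open_nbhs_nbhs (conj oV Vx)) => z Vz; exact/PO/VO.
Qed.

Lemma open_set_val (W : topologicalType) (C : set W) (U : set W) :
  open U -> open (set_val @^-1` U : set (set_type C)).
Proof. by move=> oU; exists U. Qed.

Lemma closed_set_val (W : topologicalType) (C : set W) (U : set W) :
  closed U -> closed (set_val @^-1` U : set (set_type C)).
Proof.
by move=> /closed_openC oU; rewrite -openC preimage_setC; exact: open_set_val.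
Qed.

Lemma set_type_openP (W : topologicalType) (C : set W) (V : set (set_type C)) :
  open V -> exists2 U : set W, open U & V = set_val @^-1` U.
Proof. by move=> [U oU <-]; exists U. Qed.

Lemma set_val_closed (W : topologicalType) (C : set W) (F : set (set_type C)) :
  closed C -> closed F -> closed (set_val @` F).
Proof.
move=> cC /closed_openC/set_type_openP[U oU FU].
suff -> : set_val @` F = C `&` ~` U by apply: closedI => //; exact: open_closedC.
have E : F = ~` (set_val @^-1` U) by rewrite -FU setCK.
rewrite eqEsubset; split=> [_ [x Fx <-]|x [Cx Ux]].
  by split; [exact: set_valP|move: Fx; rewrite E].
by exists (exist _ x (mem_set Cx)) => //; rewrite E.
Qed.

Definition closed_embedding (T W : topologicalType) (e : T -> W) :=
  [/\ continuous e, injective e & forall F, closed F -> closed (e @` F)].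

Lemma closed_embedding_set_val (W : topologicalType) (C : set W) : closed C ->
  closed_embedding (set_val : set_type C -> W).
Proof.
move=> cC; split; first exact: initial_continuous.
  by move=> x y; exact: val_inj.
by move=> F; exact: set_val_closed.
Qed.

Lemma closed_embedding_compact (T W : topologicalType) (e : T -> W) :
  compact [set: T] -> hausdorff_space W -> continuous e -> injective e ->
  closed_embedding e.
Proof.
move=> cT hW ce ie; split => // F cF; apply: compact_closed => //.
apply: continuous_compact; first exact: continuous_subspaceT.
exact: subclosed_compact cF cT _.
Qed.

Lemma closed_embedding_restrict (T W : topologicalType) (e : T -> W)
    (A : set T) (B : set W) : closed_embedding e -> closed A ->
  (forall x, A x -> B (e x)) ->
  exists e' : set_type A -> set_type B, closed_embedding e'.
Proof.
move=> [ce ie fe] cA AB.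
pose e' (x : set_type A) : set_type B :=
  exist _ (e (set_val x)) (mem_set (AB _ (set_valP x))).
exists e'; split.
- apply/continuousP => V /set_type_openP[U oU ->].
  rewrite -comp_preimage (_ : _ \o e' = e \o set_val)//.
  rewrite comp_preimage; apply: open_set_val.
  by move/continuousP : ce; exact.
- move=> x y /(congr1 set_val) /ie xy; exact: val_inj.
- move=> F cF.
  have -> : e' @` F = set_val @^-1` (e @` (set_val @` F)).
    rewrite eqEsubset; split=> [_ [x Fx <-]|y [_ [x Fx <-]] xy].
      by exists (set_val x) => //; exists x.
    by exists x => //; exact: val_inj.
  by apply: closed_set_val; apply: fe; exact: set_val_closed.
Qed.

Lemma extend_along (T W L : Type) (l0 : L) (e : T -> W) (f : T -> L) :
  injective e -> exists f' : W -> L, forall x, f' (e x) = f x.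
Proof.
move=> ie; have H w : exists l, forall x, e x = w -> l = f x.
  have [[x xw]|nx] := pselect (exists x, e x = w).
    by exists (f x) => y; rewrite -xw => /ie ->.
  by exists l0 => x xw; case: nx; exists x.
by have [f' f'P] := choice H; exists f' => x; exact: f'P.
Qed.

Lemma extend_along_within (T W L : topologicalType) (l0 : L)
    (e : T -> W) (F : set T) (f : T -> L) :
  closed_embedding e -> closed F -> {within F, continuous f} ->
  exists2 f' : W -> L, {within e @` F, continuous f'} & forall x, f' (e x) = f x.
Proof.
move=> [ce ie fe] cF cf; have [f' f'P] := extend_along l0 f ie.
exists f' => //; apply/within_continuousP => _ [x Fx <-] O oO.
rewrite f'P => Ofx.
have [V [oV Vx VO]] := (within_continuousP F f).1 cf x Fx O oO Ofx.
exists (~` (e @` (~` V))); split.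
- by apply: closed_openC; apply: fe; exact: open_closedC.
- by move=> [y Vy /ie yx]; apply: Vy; rewrite yx.
move=> w nV [y Fy yw]; rewrite -{w}yw in nV *; rewrite f'P; apply: VO => //.
by apply: contrapT => Vy; apply: nV; exists y.
Qed.

Lemma within_comp (T W L : topologicalType) (e : T -> W) (A : set W) (g : W -> L) :
  continuous e -> {within A, continuous g} ->
  {within e @^-1` A, continuous (g \o e)}.
Proof.
move=> ce /within_continuousP cg; apply/within_continuousP => x Ax O oO Ox.
have [V [oV Vx VO]] := cg _ Ax O oO Ox.
exists (e @^-1` V); split => //; first by move/continuousP: ce; exact.
by move=> z Vz Az; exact: VO.
Qed.

Section LIndBasic.
Variables (L : topologicalType) (l0 : L).

Lemma LInd_le_ord a b (X : topologicalType) :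
  ord_le a b -> LInd_le L a X -> LInd_le L b X.
Proof.
elim: a b X => I h IH [J k] X /= ab aX F f cF cf.
have [U [oU FU gU cU]] := aX F f cF cf; exists U; split => //.
case: cU => [|[i ci]]; first by left.
by have [j ij] := ab i; right; exists j; exact: IH ij ci.
Qed.

(** One statement gives both monotonicity on closed subsets and invariance under
    homeomorphism: a map on a closed set of [T] is carried to [W], extended
    there, and pulled back. *)
Lemma LInd_le_embedding a (T W : topologicalType) (e : T -> W) :
  closed_embedding e -> LInd_le L a W -> LInd_le L a T.
Proof.
elim: a T W e => J h IH T W e ee /= aW F f cF cf.
have [ce ie fe] := ee.
have [f' cf' f'P] := extend_along_within l0 ee cF cf.
have [U [oU FU [g [cg gP]] cU]] := aW _ _ (fe _ cF) cf'.
exists (e @^-1` U); split.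
- by move/continuousP : ce; exact.
- by move=> x Fx; apply: FU; exists x.
- exists (g \o e); split; first exact: within_comp.
  by move=> x Fx /=; rewrite gP ?f'P//; exists x.
- case: cU => [cU|[j cU]].
    by left; rewrite preimage_setC cU preimage_set0.
  right; exists j.
  have cA : closed (~` (e @^-1` U)).
    by apply: open_closedC; move/continuousP : ce; exact.
  have [//|e' ee'] := @closed_embedding_restrict _ _ _ _ (~` U) ee cA _.
  exact: IH ee' cU.
Qed.

Lemma LInd_le_subset a (W : topologicalType) (A B : set W) :
  closed A -> A `<=` B -> LInd_le L a (set_type B) -> LInd_le L a (set_type A).
Proof.
move=> cA AB.
have [|//|e ee] := @closed_embedding_restrict W W id A B _ cA.
  by split => [x U //|x y //|F]; rewrite image_id.
exact: LInd_le_embedding ee.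
Qed.

Lemma LInd_le_closed a (W : topologicalType) (A : set W) :
  closed A -> LInd_le L a W -> LInd_le L a (set_type A).
Proof. by move=> cA; apply: LInd_le_embedding (closed_embedding_set_val cA). Qed.

(** The condition L-Ind A < osup h, with L-Ind A = -1 for the empty set. *)
Definition LInd_lt (J : Type) (h : J -> Ord) (W : topologicalType) (A : set W) :=
  A = set0 \/ exists j, LInd_le L (h j) (set_type A).

(** The next two lemmas read the clause defining L-Ind of a closed subset [C] in
    terms of sets and maps of the ambient space; this avoids iterating the
    formation of subspaces. *)
Lemma LInd_le_sub_elim (J : Type) (h : J -> Ord) (W : topologicalType)
    (C F : set W) (f : W -> L) : closed C ->
  LInd_le L (osup h) (set_type C) -> closed F -> F `<=` C ->
  {within F, continuous f} ->
  exists (U : set W) (g : W -> L), [/\ open U, F `<=` U,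
    {within U `&` C, continuous g}, (forall x, F x -> g x = f x) &
    LInd_lt h (C `\` U)].
Proof.
move=> cC H cF FC cf.
have cv : continuous (set_val : set_type C -> W) by exact: initial_continuous.
have ee := closed_embedding_set_val cC.
have [U [oU FU [g [cg gP]] cU]] :=
  H _ (f \o set_val) (closed_set_val cF) (within_comp cv cf).
have [V oV UV] := set_type_openP oU; subst U.
have [g' g'P] := extend_along l0 g (let: And3 _ ie _ := ee in ie).
exists V, g'; split => //.
- by move=> x Fx; apply: (FU (exist _ x (mem_set (FC _ Fx)))).
- apply/within_continuousP => x [Vx Cx] O oO.
  pose x' : set_type C := exist _ x (mem_set Cx).
  rewrite -[x]/(set_val x') g'P => Ox.
  have [V1 [oQ Qx QO]] := (within_continuousP _ g).1 cg x' Vx O oO Ox.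
  have [V2 oQ' E] := set_type_openP oQ; exists V2; split => //.
    by move: Qx; rewrite E.
  move=> z V2z [Vz Cz]; pose z' : set_type C := exist _ z (mem_set Cz).
  by rewrite -[z]/(set_val z') g'P; apply: QO => //; rewrite E.
- move=> x Fx; pose x' : set_type C := exist _ x (mem_set (FC _ Fx)).
  by rewrite -[x]/(set_val x') g'P gP.
- case: cU => [cU|[j cU]]; [left|right].
    rewrite -subset0 => x [Cx Vx].
    suff : (set0 : set (set_type C)) (exist _ x (mem_set Cx)) by [].
    by rewrite -cU.
  exists j; pose C' := ~` (set_val @^-1` V : set (set_type C)).
  pose m (x : set_type (C `\` V)) : set_type C' :=
    exist _ (exist _ (set_val x) (mem_set (set_valP x).1) : set_type C)
      (mem_set (set_valP x).2).
  apply: (@LInd_le_embedding _ _ _ m _ cU); split.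
  + apply/continuousP => Q /set_type_openP[Q1 + ->] => /set_type_openP[P oP ->].
    by rewrite -2!comp_preimage; exact: open_set_val.
  + by move=> x y /(congr1 set_val)/(congr1 set_val) xy; exact: val_inj.
  + move=> G cG; have cCV : closed (C `\` V).
      by apply: closedI => //; exact: open_closedC.
    have -> : m @` G = set_val @^-1` (set_val @^-1` (set_val @` G)).
      rewrite eqEsubset; split=> [_ [x Gx <-]|y [x Gx] xy].
        by exists x.
      by exists x => //; do 2!apply: val_inj.
    by do 2!apply: closed_set_val; exact: set_val_closed.
Qed.

Lemma LInd_le_sub_intro (J : Type) (h : J -> Ord) (W : topologicalType)
    (C : set W) : closed C ->
  (forall (F : set W) (f : W -> L), closed F -> F `<=` C ->
    {within F, continuous f} ->
    exists (U : set W) (g : W -> L), [/\ open U, F `<=` U,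
      {within U `&` C, continuous g}, (forall x, F x -> g x = f x) &
      LInd_lt h (C `\` U)]) ->
  LInd_le L (osup h) (set_type C).
Proof.
move=> cC H F f cF cf.
have ee := closed_embedding_set_val cC.
have [f' cf' f'P] := extend_along_within l0 ee cF cf.
have FC : set_val @` F `<=` C by move=> _ [x _ <-]; exact: set_valP.
have [U [g [oU FU cg gP cU]]] := H _ f' (set_val_closed cC cF) FC cf'.
exists (set_val @^-1` U); split.
- exact: open_set_val.
- by move=> x Fx; apply: FU; exists x.
- exists (g \o set_val); split.
    have := within_comp (@initial_continuous _ _ (set_val : set_type C -> W)) cg.
    apply: continuous_subspaceW => x Ux; split => //; exact: set_valP.
  by move=> x Fx /=; rewrite gP ?f'P//; exists x.
- case: cU => [cU|[j cU]]; [left|right].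
    rewrite -subset0 => x Ux; suff : set0 (set_val x) by [].
    by rewrite -cU; split => //; exact: set_valP.
  exists j; have cA : closed (~` (set_val @^-1` U : set (set_type C))).
    by apply: open_closedC; exact: open_set_val.
  have [|e' ee'] := @closed_embedding_restrict _ _ _ _ (C `\` U) ee cA _.
    by move=> x Ux; split => //; exact: set_valP.
  exact: LInd_le_embedding ee' cU.
Qed.

End LIndBasic.

(** * Functions with the capped sup-distance *)

(** A separate name for the type of functions, to carry the metric of uniform
    convergence.  The distance is capped at 1 in order to be finite on all
    functions; the straight segments used below stay in this space. *)
Definition sup_space (R : realType) (T : Type) : Type := T -> R.

Section SupSpace.
Variables (R : realType) (T : Type).
Local Notation K := (sup_space R T).

HB.instance Definition _ := gen_eqMixin K.
HB.instance Definition _ := gen_choiceMixin K.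

Definition sup_dist (u v : K) : R :=
  sup [set Num.min 1 `|u t - v t| | t in [set: T]].

Lemma sup_dist_ub u v t : Num.min 1 `|u t - v t| <= sup_dist u v.
Proof.
apply: ub_le_sup; last by exists t.
by exists 1 => x [s _ <-]; rewrite ge_min lexx.
Qed.

Lemma sup_dist_le u v e : 0 <= e -> (forall t, Num.min 1 `|u t - v t| <= e) ->
  sup_dist u v <= e.
Proof.
move=> e0 H; have [[t0 _]|T0] := pselect (exists t : T, True).
  apply: ge_sup; first by exists (Num.min 1 `|u t0 - v t0|), t0.
  by move=> x [s _ <-].
rewrite /sup_dist (_ : [set _ | _ in _] = set0) ?sup0//.
by rewrite -subset0 => x [s]; case: T0; exists s.
Qed.

Lemma sup_distxx u : sup_dist u u = 0.
Proof.
apply/eqP; rewrite eq_le; apply/andP; split.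
  by apply: sup_dist_le => // t; rewrite subrr normr0 ge_min lexx orbT.
have [[t0 _]|T0] := pselect (exists t : T, True).
  by have := sup_dist_ub u u t0; rewrite subrr normr0 min_r.
rewrite /sup_dist (_ : [set _ | _ in _] = set0) ?sup0//.
by rewrite -subset0 => x [s]; case: T0; exists s.
Qed.

Lemma sup_dist_positivity u v : sup_dist u v = 0 -> u = v.
Proof.
move=> d0; apply/funext => t; have := sup_dist_ub u v t.
rewrite d0 ge_min leNgt ltr01 /=.
by rewrite normr_le0 subr_eq0 => /eqP.
Qed.

Lemma sup_dist_sym u v : sup_dist u v = sup_dist v u.
Proof. by rewrite /sup_dist; under eq_fun do rewrite distrC. Qed.

Lemma sup_dist_ge0 u v : 0 <= sup_dist u v.
Proof.
have [[t0 _]|T0] := pselect (exists t : T, True).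
  by apply: le_trans (sup_dist_ub u v t0); rewrite le_min ler01 normr_ge0.
rewrite /sup_dist (_ : [set _ | _ in _] = set0) ?sup0//.
by rewrite -subset0 => x [s]; case: T0; exists s.
Qed.

Lemma sup_dist_triangle v u w : sup_dist u w <= sup_dist u v + sup_dist v w.
Proof.
apply: sup_dist_le => [|t]; first by rewrite addr_ge0 ?sup_dist_ge0.
apply: le_trans (lerD (sup_dist_ub u v t) (sup_dist_ub v w t)).
have := ler_distD (v t) (u t) (w t).
have := normr_ge0 (u t - v t); have := normr_ge0 (v t - w t).
move: `|u t - w t| `|u t - v t| `|v t - w t| => a b c.
rewrite /Num.min; case: ifP; case: ifP; case: ifP => *; lra.
Qed.

HB.instance Definition _ := @isMetric.Build R K sup_dist sup_distxx sup_dist_positivity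
  sup_dist_sym sup_dist_triangle.

End SupSpace.


(** near-covering *)
(** A joint limit in two variables is uniform in the second one when that one
    ranges over a compact space. *)
Lemma sup_space_cvg (R : realType) (L : topologicalType) (T : Type)
    (F : set_system T) (H : T -> sup_space R L) (u : sup_space R L) : Filter F ->
  compact [set: L] ->
  (forall l : L, (fun z : T * L => u z.2 - H z.1 z.2 : R^o) @
    filter_prod F (nbhs l) --> (0 : R^o)) ->
  H @ F --> u.
Proof.
move=> FF cL cH; apply/cvgrPdist_le => e e0.
have /compact_near_coveringP nL := cL.
apply: (filterS _ (nL _ F (fun t l => `|u l - H t l| <= e) FF _)).
  move=> t Ht; apply: sup_dist_le => [|l]; first exact: ltW.
  by rewrite ge_min Ht ?orbT.
move=> l _; have /(@cvgrPdist_lt R R^o) /(_ _ e0) := cH l.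
rewrite /mdist/=.
case=> -[P Q] /= [FP lQ] PQ; exists (Q, P) => // -[l' t] [/= Ql Pt].
by have := PQ (t, l') (conj Pt Ql); rewrite /= subr0 => /ltW.
Qed.

Lemma mdist_continuous (R : realType) (L : metricType R) :
  continuous (fun z : L * L => mdist z.1 z.2 : R^o).
Proof.
move=> [x y]; apply/(@cvgrPdist_lt R R^o) => e e0 /=.
near=> z.
have : mdist x z.1 < e / 2.
  by near: z; apply: (cvgr_dist_lt (@cvg_fst _ _ (nbhs x) (nbhs y) _)); rewrite divr_gt0.
have : mdist y z.2 < e / 2.
  by near: z; apply: (cvgr_dist_lt (@cvg_snd _ _ (nbhs x) (nbhs y) _)); rewrite divr_gt0.
move=> yz xz; change (`|mdist z.1 z.2 - mdist x y| < e).
have := metric_triangle x z.1 y; have := metric_triangle z.1 z.2 y.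
have := metric_triangle z.1 x z.2; have := metric_triangle x y z.2.
rewrite (metric_sym z.2 y) (metric_sym z.1 x) => h1 h2 h3 h4.
rewrite ltr_norml; apply/andP.
by split; lra.
Unshelve. all: by end_near. Qed.

(** * The Kuratowski embedding of a compact metric ANR *)

Section Kuratowski.
Variables (R : realType) (L : metricType R).
Hypothesis cL : compact [set: L].

Definition kuratowski (x : L) : sup_space R L := fun l => Num.min 1 (mdist x l).

Lemma cap_continuous : continuous (fun z : L * L => kuratowski z.1 z.2 : R^o).
Proof.
move=> z; apply: (@continuous_min R _ (fun=> 1) (fun z => mdist z.1 z.2) z).
  exact: cvg_cst.
exact: mdist_continuous.
Qed.

Lemma kuratowski_ge0_le1 x l : 0 <= kuratowski x l <= 1.
Proof. by rewrite /kuratowski le_min ler01 mdist_ge0 ge_min lexx. Qed.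

Lemma kuratowski_inj : injective kuratowski.
Proof.
move=> x y /(congr1 (fun f => f y)); rewrite /kuratowski mdistxx.
rewrite (min_r (ler01 : (0 : R) <= 1)).
have : 0 <= mdist x y by exact: mdist_ge0.
rewrite /Num.min; case: ifPn => [_ _ /eqP|_ _ ]; first by rewrite oner_eq0.
exact: mdist_positivity.
Qed.

Lemma kuratowski_cvg (T : Type) (F : set_system T) (f g : T -> L) (x l : L) :
  Filter F -> f @ F --> x -> g @ F --> l ->
  (fun t => kuratowski (f t) (g t) : R^o) @ F --> (kuratowski x l : R^o).
Proof.
move=> FF fx gl; have fg : (fun t => (f t, g t)) @ F --> (x, l).
  exact: cvg_pair.
exact: (@cvg_comp _ _ _ (fun t => (f t, g t))
  (fun z : L * L => kuratowski z.1 z.2 : R^o) _ _ _ fg (@cap_continuous (x, l))).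
Qed.

Lemma kuratowski_continuous : continuous kuratowski.
Proof.
move=> x; apply: sup_space_cvg => // l.
rewrite -[X in _ --> X](subrr (kuratowski x l : R^o)).
apply: (@cvgB R R^o).
  by apply: kuratowski_cvg; [exact: cvg_cst|exact: cvg_snd].
by apply: kuratowski_cvg; [exact: cvg_fst|exact: cvg_snd].
Qed.

(** The retraction onto the image of the embedding is followed by the inverse of
    the embedding, so that the maps constructed with it land in [L]. *)
Lemma ANR_retraction : ANR R L -> [set: L] !=set0 ->
  exists (O : set (sup_space R L)) (r : sup_space R L -> L),
    [/\ open O, forall l, O (kuratowski l), {within O, continuous r} &
      forall l, r (kuratowski l) = l].
Proof.
move=> anrL [l0 _]; pose A := range kuratowski.
have hK : hausdorff_space (sup_space R L) by exact: metric_hausdorff.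
have ek : closed_embedding kuratowski.
  by apply: closed_embedding_compact => //;
    [exact: kuratowski_continuous|exact: kuratowski_inj].
have [ck ik fk] := ek.
have cA : closed A by exact: fk closedT.
have [s cs sP] := extend_along_within l0 ek (@closedT _) (continuous_subspaceT (fun x => @cvg_id _ (nbhs x))).
have AK x : A (kuratowski x) by exists x.
have hA : homeomorphic L (set_type A).
  exists (fun x => exist _ (kuratowski x) (mem_set (AK x))).
  exists (s \o set_val); split.
  - apply/continuousP => _ /set_type_openP[U oU ->].
    rewrite -comp_preimage; move/continuousP: ck; exact.
  - by apply/subspace_sigL_continuousP.
  - by move=> x /=; rewrite sP.
  - move=> a; apply: val_inj; have [x _ xa] := set_valP a.
    have E : set_val a = kuratowski x := esym xa.
    by change (kuratowski (s (set_val a)) = set_val a); rewrite E sP.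
have [N [r [oN AN cr rA rP]]] := anrL _ A cA hA.
exists N, (s \o r); split => //.
- by move=> l; apply: AN.
- apply/within_continuousP => x Ox P oP sP'.
  have Arx : A (r x) by apply: rA; exists x.
  have [V [oV Vx VP]] := (within_continuousP _ _).1 cs _ Arx P oP sP'.
  have [V1 [oV1 V1x V1P]] := (within_continuousP _ _).1 cr _ Ox V oV Vx.
  exists V1; split => // z V1z Oz; apply: VP; first exact: V1P.
  by apply: rA; exists z.
- by move=> l /=; rewrite rP ?sP.
Qed.

End Kuratowski.

(** * Separation and compactness *)

(** The Hausdorff property is checked on the quotient defining Z(X, Y) through
    its continuous maps to Hausdorff spaces. *)
Lemma hausdorff_separated (W : topologicalType) :
  (forall x y : W, x <> y -> exists (T : topologicalType) (f : W -> T),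
     [/\ hausdorff_space T, continuous f & f x <> f y]) ->
  hausdorff_space W.
Proof.
move=> H x y xy; apply: contrapT => /H[T [f [hT cf]]]; apply.
apply: hT => A B fxA fyB.
have [z [Az Bz]] := xy _ _ (cf _ _ fxA) (cf _ _ fyB).
by exists (f z).
Qed.

Lemma hausdorff_prod (T U : topologicalType) :
  hausdorff_space T -> hausdorff_space U -> hausdorff_space (T * U)%type.
Proof.
move=> hT hU; apply: hausdorff_separated => -[a b] [c d] xy.
have [ac|ac] := pselect (a = c); last first.
  by exists T, fst; split => //; move=> z; exact: cvg_fst.
exists U, snd; split => //; first by move=> z; exact: cvg_snd.
by move=> /= bd; apply: xy; rewrite ac bd.
Qed.

Lemma hausdorff_set_type (T : topologicalType) (A : set T) :
  hausdorff_space T -> hausdorff_space (set_type A).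
Proof.
move=> hT; apply: hausdorff_separated => x y xy.
exists T, set_val; split => //; first exact: initial_continuous.
by move=> /val_inj.
Qed.

Lemma compact_set_type (T : topologicalType) (A : set T) :
  compact A -> compact [set: set_type A].
Proof.
move=> /compact_near_coveringP cA; apply/compact_near_coveringP.
move=> I F P FF H.
have := cA I F (fun i x => forall a : set_type A, set_val a = x -> P i a) FF.
have H1 x : A x -> \near x & F, forall a : set_type A, set_val a = x -> P F a.
  move=> Ax; pose a : set_type A := exist _ x (mem_set Ax).
  have [[Q Q2] /= [Qa FQ2] QP] := H a Logic.I.
  move: Qa; rewrite nbhsE => -[_ [/set_type_openP[V oV ->] Vx] VQ].
  exists (V, Q2) => /=; first by split => //; exact: open_nbhs_nbhs.
  move=> [z i] /= [Vz Qi] b bz; apply: (QP (b, i)); split => //=.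
  by apply: VQ; rewrite /= bz.
move=> /(_ H1); apply: filterS => i Hi a _.
by apply: (Hi (set_val a)) => //; exact: set_valP.
Qed.

Lemma compactT_prod (T U : topologicalType) :
  compact [set: T] -> compact [set: U] -> compact [set: T * U].
Proof. by move=> cT cU; rewrite -setXTT; exact: compact_setX. Qed.

Lemma normal_shrink (T : topologicalType) (F U : set T) : normal_space T ->
  closed F -> open U -> F `<=` U ->
  exists V, [/\ open V, F `<=` V & closure V `<=` U].
Proof.
move=> nT cF oU FU; have /(nT F cF) : set_nbhs F U.
  by apply/set_nbhsP; exists U; split.
case => N /set_nbhsP[V [oV FV VN]] NU.
exists V; split => //; exact: subset_trans (closureS VN) NU.
Qed.

Lemma within_closed_preimage (T U : topologicalType) (A : set T) (f : T -> U)
    (Q : set U) : closed A -> {within A, continuous f} -> closed Q ->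
  closed (A `&` f @^-1` Q).
Proof.
move=> cA cf cQ; rewrite closed_setSI//.
by move/continuous_closedP : cf; exact.
Qed.

(** * Extension near the range of a retraction *)

Lemma within_cvg (T W U : topologicalType) (G : set_system T) (A : set W)
    (k : W -> U) (t : T -> W) (x : W) : Filter G ->
  {within A, continuous k} -> A x -> t @ G --> within A (nbhs x) ->
  (fun z => k (t z)) @ G --> k x.
Proof.
move=> FG /subspace_continuousP ck Ax tx.
exact: (@cvg_comp _ _ _ t k _ _ _ tx (ck x Ax)).
Qed.

Lemma withinU_eq_continuous (W U : topologicalType) (A B : set W) (f g : W -> U) :
  closed A -> closed B -> {within A, continuous f} -> {within B, continuous g} ->
  (forall x, A x -> B x -> f x = g x) ->
  exists k : W -> U, [/\ {within A `|` B, continuous k},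
    forall x, A x -> k x = f x & forall x, B x -> k x = g x].
Proof.
move=> cA cB cf cg fg.
pose k w := if pselect (A w) then f w else g w.
have kA x : A x -> k x = f x by rewrite /k; case: pselect.
have kB x : B x -> k x = g x.
  by rewrite /k; case: pselect => // Ax Bx; exact: fg.
exists k; split => //; apply: withinU_continuous => //.
- apply: subspace_eq_continuous cf => x; rewrite inE => Ax.
  by rewrite /from_subspace kA.
- apply: subspace_eq_continuous cg => x; rewrite inE => Bx.
  by rewrite /from_subspace kB.
Qed.

Section Extension.
Variables (R : realType) (L : metricType R).
Hypotheses (cL : compact [set: L]) (anrL : ANR R L) (L0 : [set: L] !=set0).

(** Tietze's theorem for maps to the function space: after uncurrying, the map
    [kuratowski \o k] is a real function on a closed subset of the compact
    space [W * L]. *)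
Lemma tietze_kuratowski (W : topologicalType) (C : set W) (k : W -> L) :
  compact [set: W] -> hausdorff_space W -> closed C ->
  {within C, continuous k} ->
  exists h : W * L -> R^o, continuous h /\
    forall w l, C w -> h (w, l) = kuratowski (k w) l.
Proof.
move=> cW hW cC ck.
have nWL : normal_space (W * L)%type.
  apply: compact_normal; last exact: compactT_prod.
  by apply: hausdorff_prod => //; exact: metric_hausdorff.
pose h0 (z : W * L) : R^o := kuratowski (k z.1) z.2.
have cCL : closed (C `*` [set: L]).
  rewrite (_ : _ `*` _ = fst @^-1` C); last first.
    by rewrite eqEsubset; split=> [z []|z] //.
  by apply: closed_comp => // z _; exact: cvg_fst.
have ch0 : {within C `*` [set: L], continuous h0}.
  apply/subspace_continuousP => -[w l] [/= Cw _].
  apply: (@kuratowski_cvg R L _ _ (fun z : W * L => k z.1) snd (k w) l).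
    apply: (@within_cvg _ _ _ _ C k fst w _ ck Cw) => P.
    move=> wP; have H : nbhs (w, l) (fun z => C z.1 -> P z.1).
      exact: (@cvg_fst _ _ (nbhs w) (nbhs l) _ _ wP).
    have H1 : within (C `*` [set: L]) (nbhs (w, l)) (fun z => P z.1).
      exact: (@filterS _ (nbhs (w, l)) _ (fun z => C z.1 -> P z.1)
        (fun z => (C `*` [set: L]) z -> P z.1)
        (fun z Pz Cz => Pz Cz.1) H).
    exact: H1.
  apply: (@cvg_trans _ (snd @ nbhs (w, l))).
    by apply: cvg_app; exact: cvg_within.
  exact: cvg_snd.
have [z _|h [h0h ch _]] := continuous_bounded_extension nWL cCL ltr01 ch0.
  by have /andP[k0 k1] := kuratowski_ge0_le1 (k z.1) z.2; rewrite ger0_norm.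
exists h; split => // w l Cw; rewrite -h0h//.
by rewrite inE.
Qed.

(** Here [p] retracts [W] onto [B], and [g] extends [f] over an open part [U0]
    of [B].  The map [G] is [g \o p] where [p] takes values away from [F]; near
    [F] it is deformed into [f] along straight segments of the function space,
    followed by the retraction onto [L].  Close to [B] the segments are short,
    so they stay in the neighbourhood where that retraction is defined.  It is
    essential that [G] is defined over all of [U0], which need not be closed,
    and not only over a neighbourhood of [F]. *)
Lemma retract_extension (W : topologicalType) (B F U0 : set W) (p : W -> W)
    (f g : W -> L) :
  compact [set: W] -> hausdorff_space W ->
  closed B -> continuous p -> (forall w, B (p w)) -> (forall w, B w -> p w = w) ->
  closed F -> {within F, continuous f} ->
  open U0 -> {within U0 `&` B, continuous g} ->
  F `&` B `<=` U0 -> (forall w, F w -> B w -> g w = f w) ->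
  exists (N : set W) (G : W -> L), [/\ open N, B `<=` N,
    {within N `&` p @^-1` U0, continuous G},
    (forall w, B w -> U0 w -> G w = g w) &
    forall w, N w -> F w -> U0 (p w) /\ G w = f w].
Proof.
move=> cW hW cB cp pB pid cF cf oU cg FU gf.
have nW : normal_space W by exact: compact_normal.
have [Q [r [oQ Qk cr rk]]] := ANR_retraction cL anrL L0.
have cFB : closed (F `&` B) by exact: closedI.
have [V0 [oV0 FV0 V0U]] := normal_shrink nW cFB oU FU.
have [V1 [oV1 FV1 V1V]] := normal_shrink nW cFB oV0 FV0.
(* The parameter of the segments: it vanishes off [V0], so [h] is used only
   where it is known to extend [g], and it equals 1 near [F] intersected with
   [B]. *)
have [u [cu u0 u1 u01]] : exists u : W -> R, [/\ continuous u,
    u @` (~` V0) `<=` [set 0], u @` (closure V1) `<=` [set 1] & range u `<=` `[0, 1]].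
  apply: urysohn_ext_itv => //.
  - exact: open_closedC.
  - exact: closed_closure.
  - by rewrite -subset0 => x [nV /V1V].
have [k [ck kF kB]] : exists k : W -> L, [/\
    {within F `|` (B `&` closure V0), continuous k},
    forall x, F x -> k x = f x & forall x, (B `&` closure V0) x -> k x = g x].
  apply: withinU_eq_continuous => //.
  - by apply: closedI => //; exact: closed_closure.
  - by apply: continuous_subspaceW cg => x [Bx /V0U].
  - by move=> x Fx [Bx _]; rewrite gf.
have cC : closed (F `|` (B `&` closure V0)).
  by apply: closedU => //; apply: closedI => //; exact: closed_closure.
have [h [ch hE]] := tietze_kuratowski cW hW cC ck.
pose Psi w : sup_space R L := fun l =>
  (1 - u (p w)) * kuratowski (g (p w)) l + u (p w) * h (w, l).
pose A0 := p @^-1` U0.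
have cgp : {within A0, continuous (g \o p)}.
  by apply: continuous_subspaceW (within_comp cp cg) => w Uw; split.
have cPsi : {within A0, continuous Psi}.
  apply/subspace_continuousP => w Aw; apply: sup_space_cvg => // l.
  have H (t : W * L -> W) :
      t @ filter_prod (within A0 (nbhs w)) (nbhs l) --> within A0 (nbhs w) ->
      (fun z => Psi (t z) z.2 : R^o) @ filter_prod (within A0 (nbhs w)) (nbhs l)
        --> (Psi w l : R^o).
    move=> tw; set G := filter_prod _ _ in tw *.
    have tw' : t @ G --> w by apply: cvg_trans tw _; exact: cvg_within.
    have upt : (fun z => u (p (t z)) : R^o) @ G --> (u (p w) : R^o).
      apply: (@cvg_comp _ _ _ t (u \o p) _ _ _ tw').
      by apply: continuous_comp; [exact: cp|exact: cu].
    apply: (@cvgD R R^o).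
      apply: cvgM; first by apply: (@cvgB R R^o) => //; exact: cvg_cst.
      apply: (@kuratowski_cvg R L _ G (fun z => g (p (t z))) snd (g (p w)) l).
        exact: (@within_cvg _ _ _ G A0 (g \o p) t w _ cgp Aw tw).
      exact: cvg_snd.
    apply: cvgM => //.
    have tl : (fun z => (t z, z.2)) @ G --> (w, l).
      by apply: cvg_pair => //; exact: cvg_snd.
    exact: (@cvg_comp _ _ _ (fun z => (t z, z.2)) h _ _ _ tl (ch (w, l))).
  rewrite -[X in _ --> X](subrr (Psi w l : R^o)).
  apply: (@cvgB R R^o); last by apply: H; exact: cvg_fst.
  apply: (H (fun=> w)) => P wP.
  apply: (@filterE _ (filter_prod (within A0 (nbhs w)) (nbhs l)) _ (fun=> P w)).
  move=> _.
  exact: (nbhs_singleton (wP : nbhs w (fun z => A0 z -> P z)) Aw).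
have PsiB w : B w -> U0 w -> Psi w = kuratowski (g w).
  move=> Bw Uw; apply/funext => l; rewrite /Psi pid//.
  have [Vw|Vw] := pselect (V0 w).
    have BV : (B `&` closure V0) w by split => //; exact: subset_closure.
    by rewrite hE ?kB//; [ring|right].
  by rewrite (u0 (u w)); [ring|exists w].
have Psi0 w : ~ V0 (p w) -> Psi w = kuratowski (g (p w)).
  move=> Vw; apply/funext => l; rewrite /Psi (u0 (u (p w))); first by ring.
  by exists (p w).
have PsiF w : F w -> V1 (p w) -> Psi w = kuratowski (f w).
  move=> Fw Vw; apply/funext => l; rewrite /Psi (u1 (u (p w))); last first.
    by exists (p w) => //; exact: subset_closure.
  by rewrite hE ?kF; [ring| |left].
have cKV : closed (p @^-1` closure V0).
  by apply: closed_comp => [w _|]; [exact: cp|exact: closed_closure].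
(* [D] is where the chosen point of the segment lies outside the domain of the
   retraction, [E] where [F] is not close enough to [B]; both are closed and
   disjoint from [B]. *)
pose D := (p @^-1` closure V0) `&` Psi @^-1` (~` Q).
have cD : closed D.
  apply: within_closed_preimage => //; last exact: open_closedC.
  by apply: continuous_subspaceW cPsi => w /V0U.
pose E := F `&` p @^-1` (~` V1).
have cE : closed E.
  apply: closedI => //; apply: closed_comp => [w _|]; first exact: cp.
  exact: open_closedC.
have PsiQ w : ~ D w -> A0 w -> Q (Psi w).
  move=> nD Aw; apply: contrapT => nQ; apply: nD; split => //.
  apply: subset_closure; apply: contrapT => nV.
  by apply: nQ; rewrite Psi0.
exists (~` D `&` ~` E), (r \o Psi); split.
- by apply: openI; exact: closed_openC.
- move=> w Bw; split => [[Vw]|[Fw]].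
    by apply; rewrite /= PsiB//; apply: V0U; rewrite -(pid w).
  by rewrite /= pid//; apply; exact: FV1.
- apply/within_continuousP => w [[Dw _] Aw] P oP Pw.
  have [V [oV Vw VP]] :=
    (within_continuousP Q r).1 cr _ (PsiQ _ Dw Aw) P oP Pw.
  have [V' [oV' V'w V'V]] := (within_continuousP A0 Psi).1 cPsi _ Aw V oV Vw.
  exists V'; split => // z V'z [[Dz _] Az].
  by apply: VP; [exact: V'V|exact: PsiQ].
- by move=> w Bw Uw /=; rewrite PsiB// rk.
- move=> w [Dw Ew] Fw; have Vw : V1 (p w).
    by apply: contrapT => nV; apply: Ew.
  split; last by rewrite /= PsiF// rk.
  by apply/V0U/subset_closure/V1V/subset_closure.
Qed.
End Extension.

(** * L-Ind of finite disjoint unions *)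

Section Unions.
Variables (L : topologicalType) (l0 : L).

Lemma LInd_lt_le (J : Type) (h : J -> Ord) (W : topologicalType) (A : set W) :
  LInd_lt L h A -> LInd_le L (osup h) (set_type A).
Proof.
case=> [->|[j hj]].
  move=> F f cF cf; exists setT; split; first exact: openT.
  - by [].
  - exists f; split => //.
    by move=> x; have : set0 (set_val (x : set_type (@set0 W))) := set_valP x.
  - by left; rewrite setCT.
apply: LInd_le_ord hj; apply: ord_lt_le; exists j; exact: ord_le_refl.
Qed.

Lemma LInd_lt_subset (J : Type) (h : J -> Ord) (W : topologicalType)
    (A B : set W) : closed A -> A `<=` B -> LInd_lt L h B ->
  LInd_lt L h A.
Proof.
move=> cA AB [B0|[j hj]]; [left|right].
  by rewrite -subset0 -B0.
by exists j; exact: LInd_le_subset hj.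
Qed.

Let union_ok a := forall (W : topologicalType) (A B : set W),
  closed A -> closed B -> A `&` B = set0 ->
  LInd_le L a (set_type A) -> LInd_le L a (set_type B) ->
  LInd_le L a (set_type (A `|` B)).

Let rest_setU (J : Type) (h : J -> Ord) : (forall j, union_ok (h j)) ->
  forall (W : topologicalType) (A B : set W),
  closed A -> closed B -> A `&` B = set0 ->
  LInd_lt L h A -> LInd_lt L h B -> LInd_lt L h (A `|` B).
Proof.
move=> IH W A B cA cB AB [->|[i hi]]; first by rewrite set0U.
case=> [->|[j hj]]; first by rewrite setU0; right; exists i.
right; have [ij|ji] := ord_le_total (h i) (h j).
  by exists j; apply: IH => //; exact: LInd_le_ord hi.
by exists i; apply: IH => //; exact: LInd_le_ord hj.
Qed.

(** Extensions obtained on disjoint closed sets can be used together, and the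
    larger of the two bounds, which exists by totality of the order, bounds
    both remainders. *)
Lemma LInd_le_setU a (W : topologicalType) (A B : set W) :
  closed A -> closed B -> A `&` B = set0 ->
  LInd_le L a (set_type A) -> LInd_le L a (set_type B) ->
  LInd_le L a (set_type (A `|` B)).
Proof.
elim: a W A B => J h IH W A B cA cB AB hA hB.
apply: LInd_le_sub_intro => //; first exact: closedU.
move=> F f cF FAB cf.
have [U1 [g1 [oU1 FU1 cg1 g1f r1]]] := @LInd_le_sub_elim L l0 J h W A (F `&` A) f
  cA hA (closedI cF cA) (@subIsetr _ _ _) (continuous_subspaceW (@subIsetl _ _ _) cf).
have [U2 [g2 [oU2 FU2 cg2 g2f r2]]] := @LInd_le_sub_elim L l0 J h W B (F `&` B) f
  cB hB (closedI cF cB) (@subIsetr _ _ _) (continuous_subspaceW (@subIsetl _ _ _) cf).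
have nAB x : A x -> ~ B x by move=> Ax Bx; have : (A `&` B) x by []; rewrite AB.
pose g x := if pselect (A x) then g1 x else g2 x.
have gA x : A x -> g x = g1 x by rewrite /g; case: pselect.
have gB x : B x -> g x = g2 x.
  by rewrite /g; case: pselect => // Ax Bx; case: (nAB _ Ax).
have oAC : open (~` A) by exact: closed_openC.
have oBC : open (~` B) by exact: closed_openC.
exists ((U1 `\` B) `|` (U2 `\` A)), g; split.
- by apply: openU; exact: openI.
- move=> x Fx; have [Ax|Bx] := FAB x Fx; [left|right].
    by split; [exact: FU1|exact: nAB].
  by split; [exact: FU2|move=> /nAB].
- apply/within_continuousP => x [Ux ABx] P oP Px; case: ABx => [Ax|Bx].
    case: Ux => [[U1x Bx]|[_ //]]; move: Px; rewrite gA// => Px.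
    have [V [oV Vx VP]] := (within_continuousP _ _).1 cg1 x (conj U1x Ax) P oP Px.
    exists (V `\` B); split => //; first exact: openI.
    move=> z [Vz Bz] [Uz [Az|//]]; rewrite gA//; apply: VP => //; split => //.
    by case: Uz => [[]|[_]].
  have Ax : ~ A x by move=> /nAB.
  case: Ux => [[_ //]|[U2x _]]; move: Px; rewrite gB// => Px.
  have [V [oV Vx VP]] := (within_continuousP _ _).1 cg2 x (conj U2x Bx) P oP Px.
  exists (V `\` A); split => //; first exact: openI.
  move=> z [Vz Az] [Uz [//|Bz]]; rewrite gB//; apply: VP => //; split => //.
  by case: Uz => [[_]|[]].
- move=> x Fx; have [Ax|Bx] := FAB x Fx; first by rewrite gA// g1f.
  by rewrite gB// g2f.
- rewrite (_ : _ `\` _ = (A `\` U1) `|` (B `\` U2)); last first.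
    rewrite eqEsubset; split=> x.
      move=> [[Ax|Bx] nU]; [left|right]; split => // Ux; apply: nU; [left|right].
        by split => //; exact: nAB.
      by split => // /nAB.
    move=> [[Ax nU]|[Bx nU]]; split; [by left| |by right|].
      by move=> [[]//|[_]].
    by move=> [[_]//|[]].
  apply: rest_setU => //.
  + by apply: closedI => //; exact: open_closedC.
  + by apply: closedI => //; exact: open_closedC.
  + by rewrite -subset0 => x [[Ax _] [Bx _]]; exact: nAB Bx.
Qed.

Lemma LInd_lt_setU (J : Type) (h : J -> Ord) (W : topologicalType)
    (A B : set W) : closed A -> closed B -> A `&` B = set0 ->
  LInd_lt L h A -> LInd_lt L h B -> LInd_lt L h (A `|` B).
Proof. by apply: rest_setU => j; exact: LInd_le_setU. Qed.

Lemma LInd_lt_bigcup (J : Type) (h : J -> Ord) (W : topologicalType)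
    (I : choiceType) (s : seq I) (A : I -> set W) :
  (forall i, i \in s -> closed (A i)) ->
  (forall i j x, A i x -> A j x -> i = j) ->
  (forall i, i \in s -> LInd_lt L h (A i)) ->
  LInd_lt L h (\bigcup_(i in [set` s]) A i) /\
  closed (\bigcup_(i in [set` s]) A i).
Proof.
elim: s => [|i s IH] cA dA hA.
  rewrite (_ : \bigcup_(_ in _) _ = set0); last by rewrite -subset0 => x [].
  by split; [left|exact: closed0].
have [hs cs] : LInd_lt L h (\bigcup_(i in [set` s]) A i) /\
    closed (\bigcup_(i in [set` s]) A i).
  apply: IH => // j js; [apply: cA|apply: hA]; by rewrite inE js orbT.
have Ei : i \in i :: s by rewrite inE eqxx.
have E : \bigcup_(j in [set` i :: s]) A j = A i `|` \bigcup_(j in [set` s]) A j.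
  rewrite eqEsubset; split=> [x [j /=]|x [Aix|[j js Ajx]]].
  - by rewrite inE => /orP[/eqP ->|js] Ajx; [left|right; exists j].
  - by exists i.
  - by exists j => //=; rewrite inE; apply/orP; right.
have [si|si] := boolP (i \in s).
  suff -> : \bigcup_(j in [set` i :: s]) A j = \bigcup_(j in [set` s]) A j by [].
  rewrite E; apply/setUidPr => x Aix; by exists i.
rewrite E; split; last by apply: closedU => //; exact: cA.
apply: LInd_lt_setU => //; [exact: cA| |exact: hA].
rewrite -subset0 => x [Aix [j js Ajx]].
by have ij := dA _ _ _ Aix Ajx; move: si; rewrite ij js.
Qed.

End Unions.

(** * Spaces fibred over an index with a point at infinity *)

Lemma open_within_local (W L : topologicalType) (U : set W) (g : W -> L) :
  (forall x, U x -> exists (V : set W) (k : W -> L),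
    [/\ open V, V x, V `<=` U, {within V, continuous k} &
        forall z, V z -> g z = k z]) ->
  open U /\ {within U, continuous g}.
Proof.
move=> H; split.
  rewrite openE => x /H[V [k [oV Vx VU _ _]]].
  by apply: filterS VU _; exact: open_nbhs_nbhs.
apply/within_continuousP => x Ux P oP Px.
have [V [k [oV Vx VU ck gk]]] := H x Ux.
have [V1 [oV1 V1x V1P]] := (within_continuousP V k).1 ck x Vx P oP
  (eq_ind _ P Px _ (gk x Vx)).
exists (V1 `&` V); split => //; first exact: openI.
by move=> z [V1z Vz] _; rewrite gk//; exact: V1P.
Qed.

(** Isolated among the values of [p] on the fibre of [q] through [w]. *)
Definition fibre_isolated (W : topologicalType) (M : choiceType)
    (q : W -> option M) (p : W -> W) (w : W) :=
  exists V, [/\ open V, V (p w) &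
    forall w', q w' = q w -> V (p w') -> p w' = p w].

(** In this section [q] plays the role of a map to a one-point compactification,
    with [None] at infinity, and [p] retracts [W] onto the fibre over [None],
    called the base.  Continuity of [q] at infinity follows from compactness
    ([base_nbhs_cofinite]). *)
Section Fibred.
Variables (R : realType) (L : metricType R).
Hypotheses (cL : compact [set: L]) (anrL : ANR R L) (l0 : L).
Variables (W : topologicalType) (M : choiceType) (q : W -> option M)
  (p : W -> W).
Hypotheses (cW : compact [set: W]) (hW : hausdorff_space W).
Hypotheses (oq : forall m, open [set w | q w = Some m])
  (cq : forall m, closed [set w | q w = Some m]).
Hypotheses (cp : continuous p) (qp : forall w, q (p w) = None)
  (pid : forall w, q w = None -> p w = w).

Let B := [set w | q w = None].
Let fib m := [set w | q w = Some m].

Lemma base_closed : closed B.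
Proof.
rewrite -openC (_ : ~` B = \bigcup_(m in [set: M]) fib m).
  by apply: bigcup_open => m _; exact: oq.
rewrite eqEsubset; split=> w; last by move=> [m _]; rewrite /B /fib /= => ->.
by rewrite /B /=; case E : (q w) => [m|//] _; exists m.
Qed.

Lemma off_open (s : seq M) : open [set w | forall m, m \in s -> q w <> Some m].
Proof.
elim: s => [|m s IH].
  by rewrite (_ : [set _ | _] = setT) ?eqEsubset//; exact: openT.
rewrite (_ : [set _ | _] = ~` fib m `&` [set w | forall m, m \in s -> q w <> Some m]).
  by apply: openI => //; apply: closed_openC; exact: cq.
rewrite eqEsubset; split=> w.
  move=> H; split; first by apply: H; rewrite inE eqxx.
  by move=> m' ms; apply: H; rewrite inE ms orbT.
by move=> [wm H] m'; rewrite inE => /orP[/eqP -> //|/H].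
Qed.

Lemma off_closed (s : seq M) :
  closed [set w | forall m, m \in s -> q w <> Some m].
Proof.
rewrite -openC (_ : ~` _ = \bigcup_(m in [set` s]) fib m).
  by apply: bigcup_open => m _; exact: oq.
rewrite eqEsubset; split => w; last by move=> [m ms qw] ow; exact: (ow m ms).
move=> nw; apply: contrapT => H; apply: nw => m ms qw.
by apply: H; exists m.
Qed.

Lemma base_nbhs_cofinite (N : set W) : open N -> B `<=` N ->
  exists s : seq M, forall w, (forall m, m \in s -> q w <> Some m) -> N w.
Proof.
move=> oN BN; pose F := filter_from [set: seq M]
  (fun s => [set t : seq M | {subset s <= t}]).
have FF : Filter F.
  apply: filter_from_filter; first by exists [::].
  move=> s t _ _; exists (s ++ t) => // r sr; split => x xs; apply: sr;
    by rewrite mem_cat xs ?orbT.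
have /compact_near_coveringP/(_ _ F
  (fun s w => N w \/ exists2 m, m \in s & q w = Some m) FF) := cW.
case=> [w _|s _ sP].
  case E : (q w) => [m|].
    exists (fib m, [set t : seq M | {subset [:: m] <= t}]) => /=.
      split; last by exists [:: m].
      by apply: open_nbhs_nbhs; split => //; exact: oq.
    move=> [w' t] /= [qw mt]; right; exists m => //.
    by apply: mt; rewrite inE.
  exists (N, setT) => /=; last by move=> [w' t] /= [Nw _]; left.
  split; last exact: filterT.
  by apply: open_nbhs_nbhs; split => //; exact: BN.
exists s => w H; have [//|[m ms wm]] := sP s (fun x xs => xs) w Logic.I.
by case: (H m ms).
Qed.

(** The remainder of the extension splits into two closed parts.  The set [D]
    lies in finitely many fibres and is treated by the bounds on their L-Ind.
    Elsewhere the map is extended from the base by [retract_extension], and by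
    a constant at the points whose [p]-value is isolated in their fibre; this
    leaves the set [C]. *)
Lemma fibred_extension (J : Type) (h : J -> Ord) (F : set W) (f : W -> L) :
  LInd_le L (osup h) (set_type B) ->
  (forall m, LInd_le L (osup h) (set_type (fib m))) ->
  closed F -> {within F, continuous f} ->
  exists (U : set W) (g : W -> L) (C D : set W),
    [/\ open U, F `<=` U, {within U, continuous g}, forall x, F x -> g x = f x &
    [/\ ~` U = C `|` D, closed C, closed D, C `&` D = set0 &
    [/\ LInd_lt L h D, LInd_lt L h (C `&` B),
        forall w, C w -> C (p w) &
        forall w, C w -> q w <> None -> ~ fibre_isolated q p w]]].
Proof.
move=> hB hf cF cf; have cB := base_closed.
have [U0 [g0 [oU0 FU0 cg0 g0f r0]]] := @LInd_le_sub_elim L l0 J h W B (F `&` B) f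
  cB hB (closedI cF cB) (@subIsetr _ _ _) (continuous_subspaceW (@subIsetl _ _ _) cf).
have L0 : [set: L] !=set0 by exists l0.
have [N [G [oN BN cG Gg GF]]] := retract_extension cL anrL L0 cW hW cB cp qp pid
  cF cf oU0 cg0 FU0 (fun w Fw Bw => g0f w (conj Fw Bw)).
have [s sN] := base_nbhs_cofinite oN BN.
have /choice[Ug Ugp] m : exists Ug : set W * (W -> L),
    [/\ open Ug.1, F `&` fib m `<=` Ug.1, {within Ug.1 `&` fib m, continuous Ug.2},
      (forall x, (F `&` fib m) x -> Ug.2 x = f x) & LInd_lt L h (fib m `\` Ug.1)].
  have [U1 [g1 ?]] := @LInd_le_sub_elim L l0 J h W (fib m) (F `&` fib m) f
    (@cq m) (hf m) (closedI cF (@cq m)) (@subIsetr _ _ _)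
    (continuous_subspaceW (@subIsetl _ _ _) cf).
  by exists (U1, g1).
(* [s] lists the exceptional fibres, where the map [(Ug m).2] is used. *)
pose off := [set w | forall m, m \in s -> q w <> Some m].
have oo : open off := off_open s.
pose iso := [set w | q w <> None /\ fibre_isolated q p w].
pose U := [set w | (off w /\ (U0 (p w) \/ iso w)) \/
  exists2 m, m \in s & q w = Some m /\ (Ug m).1 w].
pose G1 w := if pselect (U0 (p w)) then G w else l0.
pose g w := if q w is Some m then if m \in s then (Ug m).2 w else G1 w else G1 w.
have goff w : off w -> g w = G1 w.
  rewrite /g /off /=; case: (q w) => [m|//] H.
  by case: ifPn => // /H.
have gs w m : q w = Some m -> m \in s -> g w = (Ug m).2 w.
  by rewrite /g => -> ->.
have G1U w : U0 (p w) -> G1 w = G w by rewrite /G1; case: pselect.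
have G1n w : ~ U0 (p w) -> G1 w = l0 by rewrite /G1; case: pselect.
have [oU cg] : open U /\ {within U, continuous g}.
  apply: open_within_local => x; case=> [[ox [Ux|ix]]|[m ms [qx Ux]]].
  - exists (off `&` (N `&` p @^-1` U0)), G; split => //.
    + apply: openI => //; apply: openI => //.
      by apply: open_comp => // w _; exact: cp.
    + by split => //; split => //; exact: sN.
    + by move=> z [oz [_ Uz]]; left; split => //; left.
    + by apply: continuous_subspaceW cG => z [].
    + by move=> z [oz [_ Uz]]; rewrite goff// G1U.
  - have [Ux|Ux] := pselect (U0 (p x)).
      exists (off `&` (N `&` p @^-1` U0)), G; split => //.
      + apply: openI => //; apply: openI => //.
        by apply: open_comp => // w _; exact: cp.
      + by split => //; split => //; exact: sN.
      + by move=> z [oz [_ Uz]]; left; split => //; left.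
      + by apply: continuous_subspaceW cG => z [].
      + by move=> z [oz [_ Uz]]; rewrite goff// G1U.
    have [+ [V [oV Vx Viso]]] := ix; case qx : (q x) => [m|//] _.
    rewrite qx in Viso.
    exists (off `&` (fib m `&` p @^-1` V)), (fun=> l0); split.
    + apply: openI => //; apply: openI; first exact: oq.
      by apply: open_comp => // w _; exact: cp.
    + by split.
    + move=> z [oz [qz Vz]]; left; split => //; right; split; first by rewrite qz.
      by exists V; split => // w'; rewrite qz (Viso z)//; exact: Viso.
    + by apply: continuous_subspaceT => z; exact: cvg_cst.
    + by move=> z [oz [qz Vz]]; rewrite goff// G1n// (Viso z).
  - have [oUg FUg cUg Ugf rUg] := Ugp m.
    exists ((Ug m).1 `&` fib m), (Ug m).2; split => //.
    + by apply: openI => //; exact: oq.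
    + by move=> z [Uz qz]; right; exists m.
    + by move=> z [Uz qz]; rewrite (gs z m).
have Foff w : F w -> off w -> U0 (p w) /\ G w = f w.
  by move=> Fw ow; apply: GF => //; exact: sN.
have Fs w : ~ off w -> exists2 m, m \in s & q w = Some m.
  move=> nw; apply: contrapT => H; apply: nw => m ms qw.
  by apply: H; exists m.
have cU : closed (~` U) by exact: open_closedC.
set D := \bigcup_(m in [set` s]) (fib m `\` U).
have [rD cD] : LInd_lt L h D /\ closed D.
  apply: (LInd_lt_bigcup l0) => [m _|m m' x [qm _] [qm' _]|m ms].
  - by apply: closedI => //; exact: cq.
  - by move: qm; rewrite /fib/= qm' => -[].
  - have [_ _ _ _ r1] := Ugp m.
    apply: (LInd_lt_subset l0 _ _ r1); first by apply: closedI => //; exact: cq.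
    by move=> w [qw nU]; split => // Uw; apply: nU; right; exists m.
have offN w : ~ U w -> off w -> ~ U0 (p w).
  by move=> nU ow Uw; apply: nU; left; split => //; left.
exists U, g, (off `\` U), D; split => //.
- move=> w Fw; have [ow|/Fs[m ms qw]] := pselect (off w).
    by left; split => //; left; have [] := Foff w Fw ow.
  by right; exists m => //; split => //; have [_ + _ _ _] := Ugp m; apply.
- move=> w Fw; have [ow|/Fs[m ms qw]] := pselect (off w).
    by have [Uw Gw] := Foff w Fw ow; rewrite goff// G1U.
  by rewrite (gs w m)//; have [_ _ _ + _] := Ugp m; apply.
split => //.
- rewrite eqEsubset; split => [w nU|w [[]//|[m _ []]//]].
  have [ow|/Fs[m ms qw]] := pselect (off w); first by left.
  by right; exists m => //; split.
- by apply: closedI => //; exact: off_closed.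
- by rewrite -subset0 => w [[ow _] [m ms [qw _]]]; exact: (ow m ms).
split => //.
- apply: (LInd_lt_subset l0 _ _ r0).
    by apply: closedI => //; apply: closedI => //; exact: off_closed.
  by move=> w [[ow nU] Bw]; split => // Uw; apply: (offN w nU ow); rewrite pid.
- move=> w [ow nU]; split; first by move=> m _; rewrite qp.
  case=> [[_ [Uw|[]]]|[m _ []]]; rewrite ?qp//.
  by apply: (offN w nU ow); rewrite -[p w]pid.
- by move=> w [ow nU] qw iw; apply: nU; left; split => //; right.
Qed.

(** If all values of [p] are isolated in their fibres, the remainder meets
    only the base and finitely many fibres, so nothing is added to the common
    bound of L-Ind of the fibres. *)
Lemma LInd_le_flat (a : Ord) :
  LInd_le L a (set_type B) -> (forall m, LInd_le L a (set_type (fib m))) ->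
  (forall w, q w <> None -> fibre_isolated q p w) ->
  LInd_le L a W.
Proof.
case: a => J h hB hf flat F f cF cf.
have [U [g [C [D [oU FU cg gf [UE cC cD CD [hD hC _ nC]]]]]]] :=
  fibred_extension hB hf cF cf.
exists U; split => //; first by exists g.
suff : LInd_lt L h (~` U) by [].
rewrite UE; apply: (LInd_lt_setU l0) => //.
rewrite -(_ : C `&` B = C)//; apply/setIidPl => w Cw.
case E : (q w) => [m|//]; have qw : q w <> None by rewrite E.
by case: (nC w Cw qw); exact: flat.
Qed.

End Fibred.

Lemma continuous_to_set_type (T W : topologicalType) (A : set W)
    (f : T -> set_type A) : continuous (set_val \o f) -> continuous f.
Proof.
move=> cf; apply/continuousP => _ /set_type_openP[U oU ->].
by rewrite -comp_preimage; move/continuousP: cf; exact.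
Qed.

Section FibredCompact.
Variables (R : realType) (L : metricType R).
Hypotheses (cL : compact [set: L]) (anrL : ANR R L) (l0 : L).

(** With one non-isolated value of [p] per fibre, the remainder of a first
    extension is, up to finitely many fibres, a space in which [p] is constant
    on each fibre, and [LInd_le_flat] applies to it. *)
Lemma LInd_le_fibred (W : topologicalType) (M : choiceType) (q : W -> option M)
    (p : W -> W) (a : Ord) :
  compact [set: W] -> hausdorff_space W ->
  (forall m, open [set w | q w = Some m]) ->
  (forall m, closed [set w | q w = Some m]) ->
  continuous p -> (forall w, q (p w) = None) ->
  (forall w, q w = None -> p w = w) ->
  LInd_le L a (set_type [set w | q w = None]) ->
  (forall m, LInd_le L a (set_type [set w | q w = Some m])) ->
  (forall m, exists x, forall w, q w = Some m -> p w <> x ->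
    fibre_isolated q p w) ->
  LInd_le L (osucc a) W.
Proof.
move=> cW hW oq cq cp qp pid hB hf sing.
case: a hB hf => J h hB hf F f cF cf.
have [U [g [C [D [oU FU cg gf [UE cC cD CD [hD _ Cp nC]]]]]]] :=
  fibred_extension cL anrL l0 cW hW oq cq cp qp pid hB hf cF cf.
exists U; split => //; first by exists g.
right; exists tt.
suff H : LInd_le L (osup h) (set_type (~` U)) by exact: H.
rewrite UE; apply: (LInd_le_setU l0) => //; last exact: LInd_lt_le.
pose q1 (x : set_type C) := q (set_val x).
pose p1 (x : set_type C) : set_type C :=
  exist _ (p (set_val x)) (mem_set (Cp _ (set_valP x))).
have cv : continuous (set_val : set_type C -> W) by exact: initial_continuous.
have ev := closed_embedding_set_val cC.
have c1q o : closed [set w | q w = o] -> closed [set x | q1 x = o].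
  by move=> co; exact: (closed_set_val co).
have sub o : closed [set w | q w = o] ->
    LInd_le L (osup h) (set_type [set w | q w = o]) ->
    LInd_le L (osup h) (set_type [set x | q1 x = o]).
  move=> co; have [//|e ee] := closed_embedding_restrict
    (B := [set w | q w = o]) ev (c1q o co) _.
  exact: (LInd_le_embedding l0 ee).
apply: (@LInd_le_flat R L cL anrL l0 _ M q1 p1).
- by apply: compact_set_type; exact: subclosed_compact cC cW _.
- exact: hausdorff_set_type.
- move=> m.
  have H : open (set_val @^-1` [set w | q w = Some m] : set (set_type C)).
    by apply: open_set_val; exact: oq.
  exact: H.
- by move=> m; exact: (c1q _ (@cq m)).
- apply: continuous_to_set_type => x.
  exact: (@continuous_comp _ _ _ (set_val : set_type C -> W) p x (@cv x)
    (cp (set_val x))).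
- by move=> x; exact: qp.
- by move=> x qx; apply: val_inj; exact: pid.
- by apply: sub => //; exact: (base_closed oq).
- by move=> m; apply: sub => //; exact: cq.
- move=> x qx; exists setT; split => //; first exact: openT.
  move=> x' qx' _; apply: val_inj => /=.
  case E : (q1 x) qx qx' => [m|//] _ qx'; have [b bP] := sing m.
  suff H (y : set_type C) : q1 y = Some m -> p (set_val y) = b.
    by rewrite [LHS]H ?[RHS]H.
  move=> qy; apply: contrapT => /(bP _ qy); apply: nC; first exact: set_valP.
  by rewrite -/(q1 y) qy.
Qed.

End FibredCompact.

(** * Products with a space having one non-isolated point *)

Lemma closed_embedding_on (T W : topologicalType) (A : set T) (e : T -> W) :
  compact [set: T] -> closed A -> hausdorff_space W -> continuous e ->
  (forall x y, A x -> A y -> e x = e y -> x = y) ->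
  closed_embedding (e \o (set_val : set_type A -> T)).
Proof.
move=> cT cA hW ce ie; apply: closed_embedding_compact => //.
- by apply: compact_set_type; exact: subclosed_compact cA cT _.
- move=> x; exact: (@continuous_comp _ _ _ (set_val : set_type A -> T) e x
    (@initial_continuous _ _ (set_val : set_type A -> T) x) (ce (set_val x))).
- by move=> x y /ie xy; apply: val_inj; apply: xy; exact: set_valP.
Qed.

Lemma continuous_pair (T U V : topologicalType) (f : T -> U) (g : T -> V) :
  continuous f -> continuous g -> continuous (fun x => (f x, g x)).
Proof.
move=> cf cg x.
exact: (@cvg_pair _ _ _ (nbhs x) (nbhs (f x)) (nbhs (g x)) _ _ _ f g
  (cf x) (cg x)).
Qed.

Section Product.
Variables (R : realType) (L : metricType R).
Hypotheses (cL : compact [set: L]) (anrL : ANR R L) (l0 : L).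

(** The fibres [{x} * Y] with [x <> b] accumulate only at [{b} * Y].  Here
    [fibred_extension] is used in another way than for Z(X, Y): the remainder
    [C] is carried into itself by the retraction onto [{b} * Y], so it lies in
    the product of [S] with a subset of [Y] of smaller L-Ind. *)
Lemma LInd_le_prod (S : topologicalType) (b : S) (Y : topologicalType) (a : Ord) :
  compact [set: S] -> hausdorff_space S -> (forall x, x <> b -> open [set x]) ->
  compact [set: Y] -> hausdorff_space Y ->
  LInd_le L a Y -> LInd_le L a (S * Y)%type.
Proof.
move=> cS hS iS; elim: a Y => J h IH Y cY hY hYa.
pose W : topologicalType := (S * Y)%type.
have cW : compact [set: W] by exact: compactT_prod.
have hW : hausdorff_space W by exact: hausdorff_prod.
pose q (w : W) := if w.1 == b then None else Some w.1.
pose p (w : W) : W := (b, w.2).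
have q0 w : q w = None <-> w.1 = b.
  by rewrite /q; case: eqP => // ?; split.
have qm w m : q w = Some m <-> w.1 = m /\ m <> b.
  rewrite /q; case: eqP => [wb|wb]; split => //.
  - by move=> [wm mb]; case: mb; rewrite -wm.
  - by move=> [<-].
  - by move=> [->].
have cf : continuous (fst : W -> S) by move=> w; exact: cvg_fst.
have cs : continuous (snd : W -> Y) by move=> w; exact: cvg_snd.
have cl1 (x : S) : closed [set x] by exact: (accessible_closed_set1 (hausdorff_accessible hS)).
have fibE m : m <> b -> [set w | q w = Some m] = fst @^-1` [set m].
  by move=> mb; rewrite eqEsubset; split=> w; [move=> /qm[]|move=> /= wm; exact/qm].
have fib0 m : m = b -> [set w | q w = Some m] = set0.
  by move=> mb; rewrite -subset0 => w /qm[].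
have oq m : open [set w | q w = Some m].
  have [mb|mb] := pselect (m = b); first by rewrite fib0//; exact: open0.
  by rewrite fibE//; apply: open_comp => [w _|]; [exact: cf|exact: iS].
have cq m : closed [set w | q w = Some m].
  have [mb|mb] := pselect (m = b); first by rewrite fib0//; exact: closed0.
  by rewrite fibE//; apply: closed_comp => [w _|]; [exact: cf|exact: cl1].
have cp : continuous p.
  move=> w; apply: cvg_pair; first exact: cvg_cst.
  exact: (cs w).
have qp w : q (p w) = None by apply/q0.
have pid w : q w = None -> p w = w by move=> /q0; case: w => s y /= ->.
have cB := base_closed oq.
have hfib o : closed [set w | q w = o] ->
    LInd_le L (osup h) (set_type [set w | q w = o]).
  move=> co; apply: (LInd_le_embedding l0 _ hYa).
  apply: (@closed_embedding_on _ _ _ (snd : W -> Y)) => // -[s y] [s' y'] /= e1 e2 ->.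
  congr (_, _); move: e1 e2; case: o {co} => [m|].
    by move=> /qm[/= -> _] /qm[/= -> _].
  by move=> /q0 /= -> /q0 /= ->.
move=> F f cF cf'.
have [U [g [C [D [oU FU cg gf [UE cC cD CD [hD hC Cp _]]]]]]] :=
  fibred_extension cL anrL l0 cW hW oq cq cp qp pid (hfib _ cB)
    (fun m => hfib _ (@cq m)) cF cf'.
exists U; split => //; first by exists g.
suff : LInd_lt L h (~` U) by [].
rewrite UE; apply: (LInd_lt_setU l0) => //.
case: hC => [C0|[j hj]]; [left|right].
  rewrite -subset0 => w Cw.
  have : (C `&` [set w | q w = None]) (p w) by split; [exact: Cp|exact: qp].
  by rewrite C0.
exists j; pose Y0 := [set y : Y | C (b, y)].
have cby : continuous (fun y : Y => (b, y) : W).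
  by move=> y; apply: cvg_pair; [exact: cvg_cst|exact: cvg_id].
have cY0 : closed Y0.
  by apply: (@closed_comp _ _ (fun y => (b, y) : W) C) => // y _; exact: cby.
have cY0' : compact [set: set_type Y0].
  by apply: compact_set_type; exact: subclosed_compact cY0 cY _.
have hY0 : LInd_le L (h j) (set_type Y0).
  have eb : closed_embedding (fun y : Y => (b, y) : W).
    by apply: closed_embedding_compact => // y y' [].
  have [|e ee] := closed_embedding_restrict
    (B := C `&` [set w | q w = None]) eb cY0 _.
    by move=> y Yy; split => //; apply/q0.
  exact: (LInd_le_embedding l0 ee).
have hj' := IH j (set_type Y0) cY0' (@hausdorff_set_type _ Y0 hY) hY0.
have cv : continuous (set_val : set_type C -> W) by exact: initial_continuous.
pose e1 (x : set_type C) : S := (set_val x).1.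
pose e2 (x : set_type C) : set_type Y0 :=
  exist _ (set_val x).2 (mem_set (Cp _ (set_valP x))).
have ce1 : continuous e1.
  move=> x; exact: (@continuous_comp _ _ _ (set_val : set_type C -> W) fst x
    (@cv x) (cf (set_val x))).
have ce2 : continuous e2.
  apply: continuous_to_set_type => x.
  exact: (@continuous_comp _ _ _ (set_val : set_type C -> W) snd x (@cv x)
    (cs (set_val x))).
apply: (LInd_le_embedding l0 _ hj').
apply: (@closed_embedding_compact _ _ (fun x => (e1 x, e2 x))).
- by apply: compact_set_type; exact: subclosed_compact cC cW _.
- by apply: hausdorff_prod => //; exact: hausdorff_set_type.
- exact: continuous_pair.
- move=> x y [x1 x2]; apply: val_inj; move: x1 x2.
  change ((set_val x).1 = (set_val y).1 -> (set_val x).2 = (set_val y).2 ->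
    set_val x = set_val y).
  by case: (set_val x) (set_val y) => [? ?] [? ?] /= -> ->.
Qed.

End Product.

(** * The values of phi *)

Lemma Aone_hausdorff (M : choiceType) : hausdorff_space (Aone M).
Proof.
apply: one_point_compactification_hausdorff; last exact: discrete_hausdorff.
move=> x _; exists [set x].
  by rewrite withinET; exact: discrete_set1.
by split; [exact: compact_set1|exact: discrete_closed].
Qed.

Lemma Aone_open1 (M : choiceType) (m : M) : open [set (Some m : Aone M)].
Proof.
have -> : [set (Some m : Aone M)] = Some @` [set m].
  by rewrite image_set1.
exact: (@one_point_compactification_open_some (discrete_topology M) _ (discrete_open _)).
Qed.

Lemma Aone_closed1 (M : choiceType) (m : M) : closed [set (Some m : Aone M)].
Proof. exact: (accessible_closed_set1 (hausdorff_accessible (@Aone_hausdorff M))). Qed.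

Lemma Aone_compact (M : choiceType) : compact [set: Aone M].
Proof. exact: one_point_compactification_compact. Qed.

Lemma tychonoff_hausdorff (R : realType) (X : topologicalType) :
  tychonoff_space X -> hausdorff_space X.
Proof.
move=> [aX crX]; apply: hausdorff_separated => x y xy.
have /(@uniform_separatorP _ R)[f [cf _ f0 f1]] :
    uniform_separator [set x] [set y].
  by apply: crX; first exact: accessible_closed_set1.
exists R, f; split => //.
rewrite (f0 (f x)); last by exists x.
rewrite (f1 (f y)); last by exists y.
by move/esym/eqP; rewrite oner_eq0.
Qed.

Section SeqFamily.
Variable (X : topologicalType).
Hypothesis hX : hausdorff_space X.

Lemma seq_family_compact (S : set X) : seq_family X S -> compact S.
Proof.
case=> [fS|[f [g [cf cg fg gf]]]].
  by apply: finite_compact.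
have -> : S = (set_val \o g) @` [set: Aone nat].
  rewrite eqEsubset; split=> [x Sx|_ [a _ <-]]; last exact: set_valP.
  by exists (f (exist _ x (mem_set Sx))) => //=; rewrite fg.
apply: continuous_compact; last exact: Aone_compact.
apply: continuous_subspaceT => a.
exact: (@continuous_comp _ _ _ g (set_val : set_type S -> X) a (cg a)
  (@initial_continuous _ _ (set_val : set_type S -> X) (g a))).
Qed.

Lemma seq_family_closed (S : set X) : seq_family X S -> closed S.
Proof. by move=> /seq_family_compact; exact: compact_closed. Qed.

(** For a finite set any point can serve as [b]. *)
Lemma seq_family_isolated (S : set X) : seq_family X S -> S !=set0 ->
  exists2 b, S b & forall x, S x -> x <> b ->
    exists V, [/\ open V, V x & forall z, S z -> V z -> z = x].
Proof.
case=> [fS [b Sb]|[f [g [cf cg fg gf]]] _].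
  exists b => // x Sx _; exists (~` (S `\` [set x])); split.
  - apply: closed_openC; apply: compact_closed => //.
    apply: finite_compact; exact: sub_finite_set fS.
  - by move=> [_]; apply.
  - by move=> z Sz nz; apply: contrapT => zx; apply: nz.
exists (set_val (g None)); first exact: set_valP.
move=> x Sx xb; pose x' : set_type S := exist _ x (mem_set Sx).
case E : (f x') => [n|]; last first.
  by case: xb; rewrite -E fg.
have : open (f @^-1` [set (Some n : Aone nat)]).
  by move/continuousP : cf; apply; exact: Aone_open1.
move=> /set_type_openP[V oV fV]; exists V; split => //.
  have : (f @^-1` [set (Some n : Aone nat)]) x' by [].
  by rewrite fV.
move=> z Sz Vz; pose z' : set_type S := exist _ z (mem_set Sz).
have : (f @^-1` [set (Some n : Aone nat)]) z' by rewrite fV.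
move=> /= fz; have : z' = x' by rewrite -(fg z') fz -E fg.
by move=> /(congr1 set_val).
Qed.

End SeqFamily.

(** * The space Z(X, Y) *)

Section ZSpace.
Variables (X Y : topologicalType) (M : choiceType) (phi : M -> set X).
Local Notation P := (Aone M * X * Y)%type.
Local Notation N := (Nspace X Y M).
Local Notation collapse := (@pi1 X Y M).
Local Open Scope quotient_scope.

Lemma collapse_eqP (z z' : P) : collapse z = collapse z' <-> z = z' \/
  [/\ z.1.1 = None, z'.1.1 = None & z.1.2 = z'.1.2].
Proof.
split; last by move=> H; apply/eqquotP/asboolP.
by move=> /eqquotP/asboolP.
Qed.

Lemma collapse_continuous : continuous collapse.
Proof. exact: pi_continuous. Qed.

(** Continuous maps on the quotient, presented as composites with the choice of
    representatives so that they can be named below. *)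
Lemma Nspace_lift (T : topologicalType) (g : P -> T) : continuous g ->
  (forall z z', z.1.1 = None -> z'.1.1 = None -> z.1.2 = z'.1.2 -> g z = g z') ->
  continuous (g \o repr : N -> T) /\ forall z, g (repr (collapse z)) = g z.
Proof.
move=> cg gP; have H z z' : collapse z = collapse z' -> g z = g z'.
  by move=> /collapse_eqP[->//|[]]; exact: gP.
split; first by apply: repr_comp_continuous => // z z' /eqP/H ->.
by move=> z /=; apply: H; rewrite /pi1 reprK.
Qed.

Local Notation Z := (Zspace Y phi).

Definition Zfibre (a : Aone M) : set X := if a is Some m then phi m else [set: X].

Lemma Zfiber_mem (z : P) : Zfibre z.1.1 z.1.2 ->
  (\bigcup_a @Zfiber X Y M phi a) (collapse z).
Proof.
case: z => [[a x] y] /= zx; exists a => //; exists (a, x, y) => //=.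
Qed.

Definition Zpoint (z : P) (zx : Zfibre z.1.1 z.1.2) : Z :=
  exist _ (collapse z) (mem_set (Zfiber_mem zx)).

Lemma Zpoint_surj (w : Z) : exists z (zx : Zfibre z.1.1 z.1.2), w = Zpoint zx.
Proof.
have [a _ [[[a' x] y] [/= [-> ax] _] ew]] := set_valP w.
exists (a, x, y), ax; apply: val_inj; exact: esym ew.
Qed.

Lemma Zpoint_eqP (z z' : P) (zx : Zfibre z.1.1 z.1.2) (zx' : Zfibre z'.1.1 z'.1.2) :
  Zpoint zx = Zpoint zx' <-> z = z' \/
  [/\ z.1.1 = None, z'.1.1 = None & z.1.2 = z'.1.2].
Proof.
rewrite -collapse_eqP; split=> [/(congr1 set_val)//|e]; exact: val_inj.
Qed.

Lemma Zpoint_continuous (T : topologicalType) (f : T -> P)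
    (fx : forall t, Zfibre (f t).1.1 (f t).1.2) :
  continuous f -> continuous (fun t => Zpoint (fx t)).
Proof.
move=> cf; apply: continuous_to_set_type => t.
exact: (@continuous_comp _ _ _ f collapse t (cf t) (@collapse_continuous _)).
Qed.

Definition Zidx (w : Z) : Aone M := (repr (set_val w)).1.1.
Definition Zx (w : Z) : X := (repr (set_val w)).1.2.

Let c11 : continuous (fun z : P => z.1.1).
Proof.
move=> z; exact: (@continuous_comp _ _ _ (fst : P -> _) fst z cvg_fst cvg_fst).
Qed.

Let c12 : continuous (fun z : P => z.1.2).
Proof.
move=> z; exact: (@continuous_comp _ _ _ (fst : P -> _) snd z cvg_fst cvg_snd).
Qed.

Lemma Zidx_point z (zx : Zfibre z.1.1 z.1.2) : Zidx (Zpoint zx) = z.1.1.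
Proof.
have [|_ H] := Nspace_lift c11; last exact: (H z).
by move=> ? ? -> ->.
Qed.

Lemma Zx_point z (zx : Zfibre z.1.1 z.1.2) : Zx (Zpoint zx) = z.1.2.
Proof. by have [|_ H] := Nspace_lift c12; last exact: (H z). Qed.

Lemma Zidx_continuous : continuous Zidx.
Proof.
have [|H _] := Nspace_lift c11; first by move=> ? ? -> ->.
move=> w; exact: (@continuous_comp _ _ _ (set_val : Z -> N) _ w
  (@initial_continuous _ _ (set_val : Z -> N) w) (H (set_val w))).
Qed.

Lemma Zx_continuous : continuous Zx.
Proof.
have [|H _] := Nspace_lift c12; first by [].
move=> w; exact: (@continuous_comp _ _ _ (set_val : Z -> N) _ w
  (@initial_continuous _ _ (set_val : Z -> N) w) (H (set_val w))).
Qed.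

Lemma Zx_fibre w : Zfibre (Zidx w) (Zx w).
Proof.
by have [z [zx ->]] := Zpoint_surj w; rewrite Zidx_point Zx_point.
Qed.

Lemma Zidx_open m : open [set w : Z | Zidx w = Some m].
Proof.
apply: (@open_comp _ _ Zidx [set (Some m : Aone M)]); last exact: Aone_open1.
by move=> w _; exact: Zidx_continuous.
Qed.

Lemma Zidx_closed m : closed [set w : Z | Zidx w = Some m].
Proof.
apply: (@closed_comp _ _ Zidx [set (Some m : Aone M)]); last exact: Aone_closed1.
by move=> w _; exact: Zidx_continuous.
Qed.

Variable y0 : Y.

(** The second coordinate makes sense on the fibre over [m] only.  This fibre is
    open and closed, so the constant value elsewhere keeps the map continuous. *)
Definition Zy m (w : Z) : Y :=
  if Zidx w == Some m then (repr (set_val w)).2 else y0.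

Let gy m (z : P) : Y := if z.1.1 == Some m then z.2 else y0.

Let cgy m : continuous (gy m).
Proof.
apply/continuous_openP => z V oV; rewrite /gy; case: eqP => [zm|zm] Vz.
  exists ([set z' | z'.1.1 = Some m] `&` (snd @^-1` V)); split => //.
    apply: openI; last by apply: open_comp => // ? _; exact: cvg_snd.
    apply: (@open_comp _ _ (fun z : P => z.1.1) [set (Some m : Aone M)]).
      by move=> ? _; exact: c11.
    exact: Aone_open1.
  by move=> z' /= [-> ?]; rewrite eqxx.
exists (~` [set z' | z'.1.1 = Some m]); split => //.
  apply: closed_openC.
  apply: (@closed_comp _ _ (fun z : P => z.1.1) [set (Some m : Aone M)]).
    by move=> ? _; exact: c11.
  exact: Aone_closed1.
by move=> z' /= /eqP/negPf ->.
Qed.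

Lemma Zy_point m z (zx : Zfibre z.1.1 z.1.2) : z.1.1 = Some m ->
  Zy m (Zpoint zx) = z.2.
Proof.
move=> zm; rewrite /Zy Zidx_point zm eqxx.
have /collapse_eqP[|[]] : collapse (repr (collapse z)) = collapse z by rewrite /pi1 reprK.
  by move=> /(congr1 snd).
by rewrite zm.
Qed.

Lemma Zy_continuous m : continuous (Zy m).
Proof.
have [|H _] := Nspace_lift (@cgy m).
  by move=> z z' z0 z0'; rewrite /gy z0 z0'.
move=> w; exact: (@continuous_comp _ _ _ (set_val : Z -> N) _ w
  (@initial_continuous _ _ (set_val : Z -> N) w) (H (set_val w))).
Qed.

Definition Zbase (x : X) : Z := @Zpoint (None, x, y0) Logic.I.

Lemma Zbase_continuous : continuous Zbase.
Proof.
apply: (Zpoint_continuous (f := fun x => (None, x, y0) : P)).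
apply: (continuous_pair (f := fun x => (None : Aone M, x)) (g := fun=> y0)).
  by apply: (continuous_pair (f := fun=> None : Aone M) (g := id)) => x;
    [exact: cvg_cst|exact: cvg_id].
by move=> x; exact: cvg_cst.
Qed.

Lemma Zidx_base x : Zidx (Zbase x) = None.
Proof. by rewrite /Zbase Zidx_point. Qed.

Lemma Zx_base x : Zx (Zbase x) = x.
Proof. by rewrite /Zbase Zx_point. Qed.

Lemma Zbase_Zx w : Zidx w = None -> Zbase (Zx w) = w.
Proof.
have [z [zx ->]] := Zpoint_surj w; rewrite Zidx_point Zx_point => z0.
by apply/Zpoint_eqP; right.
Qed.

Lemma Zspace_inj m w w' : Zidx w = Some m -> Zidx w' = Some m ->
  Zx w = Zx w' -> Zy m w = Zy m w' -> w = w'.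
Proof.
have [z [zx ->]] := Zpoint_surj w; have [z' [zx' ->]] := Zpoint_surj w'.
rewrite !Zidx_point !Zx_point => zm zm'; rewrite !Zy_point// => e1 e2.
apply/Zpoint_eqP; left; case: z z' zm zm' e1 e2 {zx zx'} => [[a x] y] [[a' x'] y'] /=.
by move=> -> -> -> ->.
Qed.

Hypotheses (hX : hausdorff_space X) (hY : hausdorff_space Y).

Lemma Zspace_hausdorff : hausdorff_space Z.
Proof.
apply: hausdorff_separated => w w' ww'.
have [ei|ei] := pselect (Zidx w = Zidx w'); last first.
  by exists (Aone M), Zidx; split => //; [exact: Aone_hausdorff|exact: Zidx_continuous].
have [ex|ex] := pselect (Zx w = Zx w'); last first.
  by exists X, Zx; split => //; exact: Zx_continuous.
case E : (Zidx w) => [m|]; last first.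
  by case: ww'; rewrite -(Zbase_Zx E) ex Zbase_Zx// -ei.
exists Y, (Zy m); split => //; first exact: Zy_continuous.
by move=> ey; apply: ww'; apply: (Zspace_inj E) => //; rewrite -ei.
Qed.

Hypotheses (cX : compact [set: X]) (cY : compact [set: Y]).
Hypothesis (cphi : forall m, closed (phi m)).

Lemma Zspace_compact : compact [set: Z].
Proof.
apply: compact_set_type.
pose K := [set z : P | Zfibre z.1.1 z.1.2].
have -> : \bigcup_a @Zfiber X Y M phi a = collapse @` K.
  rewrite eqEsubset; split=> n.
    by move=> [a _ [[[a' x] y] [/= [-> ax] _] <-]]; exists (a, x, y).
  by move=> [z Kz <-]; exact: Zfiber_mem.
apply: continuous_compact; first by apply: continuous_subspaceT; exact: collapse_continuous.
apply: (@subclosed_compact _ _ [set: P]) => //; last first.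
  by apply: compactT_prod => //; apply: compactT_prod => //; exact: Aone_compact.
rewrite -openC (_ : ~` K = \bigcup_m
   ((fun z : P => z.1.1) @^-1` [set (Some m : Aone M)] `&`
    (fun z : P => z.1.2) @^-1` (~` phi m))).
  apply: bigcup_open => m _; apply: openI; apply: open_comp.
  - by move=> z _; exact: c11.
  - exact: Aone_open1.
  - by move=> z _; exact: c12.
  - by apply: closed_openC; exact: cphi.
rewrite eqEsubset; split=> -[[a x] y]; rewrite /K /=.
  by case: a => [m|] nx; [exists m|case: nx].
by move=> [m _ [/= -> nx]].
Qed.

End ZSpace.

(** * The upper bound *)

Section Upper.
Variables (R : realType) (L : metricType R).
Hypotheses (cL : compact [set: L]) (anrL : ANR R L) (l0 : L).
Variables (X Y : topologicalType) (M : choiceType) (phi : M -> set X).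
Hypotheses (hX : hausdorff_space X) (hY : hausdorff_space Y).
Hypotheses (cX : compact [set: X]) (cY : compact [set: Y]).
Hypothesis sphi : forall m, seq_family X (phi m).
Variables (x0 : X) (y0 : Y).
Local Notation Z := (Zspace Y phi).

Let cphi m : closed (phi m).
Proof. exact: seq_family_closed. Qed.

Lemma LInd_le_Zfiber (a : Ord) (m : M) : LInd_le L a Y ->
  LInd_le L a (set_type [set w : Z | Zidx w = Some m]).
Proof.
move=> aY; have [p0|/set0P pn0] := eqVneq (phi m) set0.
  case: a aY => J h _; apply: LInd_lt_le; left.
  rewrite -subset0 => w /= wm; have := Zx_fibre w.
  by rewrite wm /= p0.
have [b pb iso] := seq_family_isolated hX (sphi m) pn0.
pose S : topologicalType := set_type (phi m).
have cS : compact [set: S].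
  by apply: compact_set_type; exact: seq_family_compact.
have hS : hausdorff_space S by exact: hausdorff_set_type.
have iS (x : S) : x <> exist _ b (mem_set pb) -> open [set x].
  move=> xb; have [|V [oV Vx VP]] := iso (set_val x) (set_valP x).
    by move=> e; apply: xb; apply: val_inj.
  rewrite (_ : [set x] = set_val @^-1` V); first exact: open_set_val.
  rewrite eqEsubset; split=> [_ -> //|z Vz].
  by apply: val_inj; apply: VP => //; exact: set_valP.
have aSY := LInd_le_prod cL anrL l0 cS hS iS cY hY aY.
pose A := [set w : Z | Zidx w = Some m].
have cA : closed A by exact: Zidx_closed.
have Ax (w : set_type A) : phi m (Zx (set_val w)).
  by have := Zx_fibre (set_val w); rewrite (set_valP w).
pose e1 (w : set_type A) : S := exist _ (Zx (set_val w)) (mem_set (Ax w)).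
pose e2 (w : set_type A) : Y := Zy y0 m (set_val w).
have cv : continuous (set_val : set_type A -> Z) by exact: initial_continuous.
have ce1 : continuous e1.
  apply: continuous_to_set_type => w.
  exact: (@continuous_comp _ _ _ (set_val : set_type A -> Z) (@Zx X Y M phi) w
    (@cv w) (@Zx_continuous _ _ _ _ (set_val w))).
have ce2 : continuous e2.
  move=> w; exact: (@continuous_comp _ _ _ (set_val : set_type A -> Z) (Zy y0 m) w
    (@cv w) (@Zy_continuous _ _ _ phi y0 m (set_val w))).
apply: (LInd_le_embedding l0 _ aSY).
apply: (@closed_embedding_compact _ _ (fun w => (e1 w, e2 w))).
- have cZ : compact [set: Z] by exact: Zspace_compact.
  by apply: compact_set_type; exact: subclosed_compact cA cZ _.
- exact: hausdorff_prod.
- exact: continuous_pair.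
- move=> w w' [x1 x2]; apply: val_inj.
  exact: (Zspace_inj (set_valP w) (set_valP w') x1 x2).
Qed.

Lemma Zspace_LInd_le (a : Ord) : LInd_le L a X -> LInd_le L a Y ->
  LInd_le L (osucc a) Z.
Proof.
move=> aX aY.
have cZ : compact [set: Z] by exact: Zspace_compact.
have hZ : hausdorff_space Z by exact: Zspace_hausdorff.
pose p (w : Z) : Z := Zbase phi y0 (Zx w).
have cx := @Zx_continuous X Y M phi.
apply: (@LInd_le_fibred R L cL anrL l0 Z M (@Zidx X Y M phi) p a) => //.
- exact: Zidx_open.
- exact: Zidx_closed.
- move=> w; exact: (@continuous_comp _ _ _ (@Zx X Y M phi) (Zbase phi y0) w
    (cx w) (@Zbase_continuous _ _ _ phi y0 _)).
- by move=> w; exact: Zidx_base.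
- by move=> w; exact: Zbase_Zx.
- have cB : closed [set w : Z | Zidx w = None] by apply: (base_closed (@Zidx_open X Y M phi)).
  apply: (LInd_le_embedding l0 _ aX).
  apply: (@closed_embedding_on _ _ _ (@Zx X Y M phi)) => // w w' /= w0 w0' e.
  by rewrite -(Zbase_Zx y0 w0) e Zbase_Zx.
- by move=> m; exact: LInd_le_Zfiber.
- move=> m; have [p0|/set0P pn0] := eqVneq (phi m) set0.
    exists (Zbase phi y0 x0) => w wm; have := Zx_fibre w.
    by rewrite wm /= p0.
  have [b pb iso] := seq_family_isolated hX (sphi m) pn0.
  have px w : Zidx w = Some m -> phi m (@Zx X Y M phi w).
    by move=> wm; have := Zx_fibre w; rewrite wm.
  exists (Zbase phi y0 b) => w wm wb.
  have [|V [oV Vw VP]] := iso (Zx w) (px w wm).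
    by move=> xb; apply: wb; rewrite /p xb.
  exists (@Zx X Y M phi @^-1` V); split.
  + by apply: open_comp => // ? _; exact: cx.
  + by rewrite /= /p Zx_base.
  + move=> w'; rewrite wm => wm' /=; rewrite /p Zx_base => Vw'.
    by rewrite (VP _ (px w' wm') Vw').
Qed.

End Upper.

(** * Sequences and cardinals *)

(** The members of a finite basis containing [b] have an open intersection,
    which in a T1 space is reduced to [b]. *)
Lemma finite_basis_isolated (X : topologicalType) (B : set (set X)) (b : X) :
  accessible_space X -> basis B -> finite_set B -> nbhs b [set b].
Proof.
move=> aX [oB nB] /finite_seqP[s Bs].
have H : nbhs b (fun z => forall V, V \in s -> V b -> V z).
  have : forall V, V \in s -> open V by move=> V Vs; apply: oB; rewrite Bs.
  elim: s {Bs} => [_|V s IH os]; first by apply: filterE => z V.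
  have : nbhs b (fun z => V b -> V z).
    have [Vb|Vb] := pselect (V b); last by apply: filterE.
    have : nbhs b V.
      by apply: open_nbhs_nbhs; split => //; apply: os; rewrite inE eqxx.
    by apply: filterS.
  apply: filterS2 (IH _) => [z Hs HV W|].
    by rewrite inE => /orP[/eqP ->//|]; exact: Hs.
  by move=> W Ws; apply: os; rewrite inE Ws orbT.
apply: filterS H => z Hz; apply: contrapT => zb.
have oz : open (~` [set z]) by apply: closed_openC; exact: accessible_closed_set1.
have [V [BV Vb] Vz] : filter_from [set U | B U /\ U b] id (~` [set z]).
  by apply: nB; apply: open_nbhs_nbhs; split => //; exact: nesym.
have : V z by apply: Hz => //; have : B V by []; rewrite Bs.
by move=> /Vz; apply.
Qed.

Section Cardinality.
Local Open Scope card_scope.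

(** The weight of [X] is infinite when [X] has a non-isolated point, and the
    cardinality of [M] exceeds it. *)
Lemma uncountable_above_weight (X : topologicalType) (M : Type) (b : X) :
  accessible_space X -> ~ nbhs b [set b] ->
  (exists2 B : set (set X), weight_basis B & card_lt B [set: M]) ->
  ~ countable [set: M].
Proof.
move=> aX nb [B [bB _] [_ nMB]] cM; apply: nMB.
have [fB|iB] := pselect (finite_set B).
  by case: nb; exact: finite_basis_isolated fB.
by apply: card_le_trans cM _; apply/infiniteP.
Qed.

Lemma Aone_nbhs_None (M : choiceType) (A : set (Aone M)) :
  A None -> finite_set [set m | ~ A (Some m)] -> nbhs (None : Aone M) A.
Proof.
move=> A0 fA.
exists ([set m | ~ A (Some m)] : set (discrete_topology M)).
  by split; [exact: finite_compact|exact: discrete_closed].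
move=> [m|] //= [[m' nA [<-]]|//]; exact: contrapT.
Qed.

(** The union [T] of the two ranges is countable, it is infinite because it
    accumulates at [b], and only finitely many of its points lie off a given
    neighbourhood of [b].  So any bijection of [nat] with [T], which sends
    infinity to [b], is continuous on the one-point compactification. *)
Lemma cvg_sequences_seq_family (X : topologicalType) (b : X) (u v : nat -> X) :
  hausdorff_space X -> u @ \oo --> b -> v @ \oo --> b ->
  (forall n, u n <> b) -> (forall n, v n <> b) ->
  seq_family X ([set b] `|` (range u `|` range v)).
Proof.
move=> hX ub vb un vn; right.
set S := [set b] `|` _; pose T := range u `|` range v.
have cT : countable T.
  have -> : T = \bigcup_i (if i then range u else range v).
    rewrite eqEsubset; split=> x; first by case=> ?; [exists true|exists false].
    by move=> [[] _ ?]; [left|right].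
  by apply: bigcup_countable => // -[] _; exact: card_image_le.
have fT (O : set X) : nbhs b O -> finite_set (T `\` O).
  move=> bO; have [n1 _ H1] := ub _ bO; have [n2 _ H2] := vb _ bO.
  have : finite_set (u @` `I_n1 `|` v @` `I_n2).
    by rewrite finite_setU; split; apply: finite_image; exact: finite_II.
  apply: sub_finite_set => x [[[n _ <-]|[n _ <-]] nO]; [left|right];
    exists n => //=; rewrite ltnNge; apply/negP => nn; apply: nO.
    exact: H1.
  exact: H2.
have nT : ~ T b by move=> [[n _ /un]|[n _ /vn]].
have iT : infinite_set T.
  move=> fT'; have cT' : closed T.
    by apply: compact_closed => //; exact: finite_compact.
  have bT : nbhs b (~` T) by apply: open_nbhs_nbhs; split => //; exact: closed_openC.
  by have [n _ /(_ n (leqnn n))] := ub _ bT; apply; left; exists n.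
have : T #= [set: nat].
  by rewrite card_eq_le; apply/andP; split; [exact: cT|exact/infiniteP].
rewrite card_eq_sym => /card_bijP[k [k' kK k'K]].
pose g (a : Aone nat) : X :=
  if a is Some n then set_val (k (exist _ n (mem_set Logic.I)) : set_type T) else b.
have gS a : S (g a).
  by case: a => [n|]; [right; exact: set_valP|left].
have g_inj : injective g.
  move=> [n|] [m|] //=.
  - by move=> /val_inj /(can_inj kK) [->].
  - by move=> e; case: nT; rewrite -e; exact: set_valP.
  - by move=> e; case: nT; rewrite e; exact: set_valP.
have cg : continuous g.
  move=> [n|] O gO.
    have H : nbhs (Some n : Aone nat) (g @^-1` O).
      rewrite nbhsE; exists [set (Some n : Aone nat)]; last first.
        by move=> a ->; exact: nbhs_singleton gO.
      by split => //; exact: Aone_open1.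
    exact: H.
  have H : nbhs (None : Aone nat) (g @^-1` O); last exact: H.
  apply: Aone_nbhs_None; first exact: nbhs_singleton gO.
  pose g1 (n : discrete_topology nat) := g (Some n).
  have -> : [set n | ~ (g @^-1` O) (Some n)] = g1 @^-1` (T `\` O).
    rewrite eqEsubset; split=> n /=; last by case.
    by split => //; exact: set_valP.
  apply: finite_preimage; last exact: fT.
  by move=> n m _ _ /g_inj [].
have sg x : S x -> exists a, g a = x.
  case=> [->|Tx]; first by exists None.
  case E : (k' (exist _ x (mem_set Tx))) => [n nP]; exists (Some n) => /=.
  rewrite (_ : exist _ n _ = k' (exist _ x (mem_set Tx))) ?k'K//.
  by rewrite E; apply: val_inj.
pose G (a : Aone nat) : set_type S := exist _ (g a) (mem_set (gS a)).
have [cG iG fG] : closed_embedding G.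
  apply: closed_embedding_compact; first exact: Aone_compact.
  - exact: hausdorff_set_type.
  - exact: continuous_to_set_type.
  - by move=> a a' /(congr1 set_val) /g_inj.
have /choice[F FG] (x : set_type S) : exists a, G a = x.
  by have [a ax] := sg _ (set_valP x); exists a; exact: val_inj.
exists F, G; split => //; last by move=> a; apply: iG; rewrite FG.
apply/continuous_closedP => C cC.
rewrite (_ : F @^-1` C = G @` C); first exact: fG.
rewrite eqEsubset; split=> [x Cx|_ [a Ca <-]]; first by exists (F x).
by rewrite /= (iG (F (G a)) a).
Qed.

End Cardinality.

(** * The lower bound *)

Lemma mdist_within (R : realType) (L : metricType R) (T : topologicalType)
    (A : set T) (g : T -> L) (x : T) (e : R) :
  {within A, continuous g} -> A x -> 0 < e ->
  exists V, [/\ open V, V x & forall z, V z -> A z -> mdist (g x) (g z) < e].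
Proof.
move=> /subspace_continuousP cg Ax e0.
have : nbhs x (fun z => A z -> mdist (g x) (g z) < e).
  exact: (cvgr_dist_lt (cg x Ax) e0).
rewrite nbhsE => -[V [oV Vx] VP].
by exists V; split.
Qed.

Lemma LInd_not_zero (R : realType) (L : metricType R) (l0 : L)
    (X : topologicalType) (K : set X) :
  closed K -> ~ LInd_le L ozero (set_type K) ->
  exists (F : set X) (f : X -> L), [/\ closed F, F `<=` K,
    {within F, continuous f} &
    forall g : X -> L, {within K, continuous g} ->
      ~ (forall x, F x -> g x = f x)].
Proof.
move=> cK nK; apply: contrapT => H; apply: nK.
apply: (LInd_le_sub_intro l0) => // F f cF FK cf.
apply: contrapT => H1; apply: H; exists F, f; split => // g cg gf.
apply: H1; exists setT, g; split => //; first exact: openT.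
  by rewrite setTI.
by left; rewrite setDT.
Qed.

Lemma extend_limits (R : realType) (L : metricType R) (X : topologicalType)
    (U K : set X) (g : X -> L) : open U -> K `<=` closure U ->
  (forall b, K b -> exists l : L, g @ within U (nbhs b) --> l) ->
  {within U, continuous g} ->
  exists2 k : X -> L, {within K, continuous k} & forall x, K x -> U x -> k x = g x.
Proof.
move=> oU KU lim cg.
have /choice[k kP] b : exists l : L, K b -> g @ within U (nbhs b) --> l.
  have [Kb|nKb] := pselect (K b); last by exists (g b).
  by have [l gl] := lim b Kb; exists l.
have kV x e : K x -> 0 < e -> exists V, [/\ open V, V x &
    forall z, V z -> U z -> mdist (k x) (g z) < e].
  move=> Kx e0; have : nbhs x (fun z => U z -> mdist (k x) (g z) < e).
    exact: (cvgr_dist_lt (kP x Kx) e0).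
  rewrite nbhsE => -[V [oV Vx] VP].
  by exists V; split.
exists k.
  apply/subspace_continuousP => x Kx; apply/cvgrPdist_lt => e e0.
  have e2 : 0 < e / 2 by rewrite divr_gt0.
  have [V [oV Vx VP]] := kV x _ Kx e2.
  suff H : nbhs x (fun x' => K x' -> mdist (k x) (k x') < e) by exact: H.
  rewrite nbhsE; exists V => // x' Vx' Kx'.
  have [V1 [oV1 V1x V1P]] := kV x' _ Kx' e2.
  have [z [Uz [Vz V1z]]] : U `&` (V `&` V1) !=set0.
    by apply: (KU x' Kx'); apply: open_nbhs_nbhs; split => //; exact: openI.
  have h1 := VP z Vz Uz; have h2 := V1P z V1z Uz.
  apply: le_lt_trans (metric_triangle _ (g z) _) _.
  by rewrite [ltRHS]splitr ltrD// metric_sym.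
move=> x Kx Ux; apply: contrapT => /eqP; rewrite -mdist_gt0 => d0.
have [V [oV Vx VP]] := kV x _ Kx d0.
by have := VP x Vx Ux; rewrite ltxx.
Qed.

Section Lower.
Variables (R : realType) (L : metricType R).
Hypotheses (cL : compact [set: L]) (l0 : L).
Variables (X Y : topologicalType) (M : choiceType) (phi : M -> set X).
Hypotheses (hX : hausdorff_space X) (hY : hausdorff_space Y).
Hypotheses (cX : compact [set: X]) (cY : compact [set: Y]).
Hypothesis sphi : forall m, seq_family X (phi m).
Hypothesis many : forall S, seq_family X S -> (phi @^-1` [set S] #= [set: M])%card.
Hypothesis weightX : exists2 B : set (set X), weight_basis B & card_lt B [set: M].
Hypothesis frX : frechet_space X.
Variable y0 : Y.
Local Notation Z := (Zspace Y phi).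

(** A neighbourhood of the point of the base over [x] contains the set over [x]
    in almost all fibres, since these sets shrink to this point. *)
Lemma Zspace_tube (U : set Z) (g : Z -> L) (x : X) (e : R) : open U ->
  {within U, continuous g} -> U (Zbase phi y0 x) -> 0 < e ->
  exists s : seq M, forall w : Z, (forall m, m \in s -> Zidx w <> Some m) ->
    Zx w = x -> U w /\ mdist (g (Zbase phi y0 x)) (g w) < e.
Proof.
move=> oU cg Ux e0; have [V [oV Vx VP]] := mdist_within cg Ux e0.
have cphi m : closed (phi m) by exact: seq_family_closed.
have oN : open ((V `&` U) `|` ~` (@Zx X Y M phi @^-1` [set x])).
  apply: openU; first exact: openI.
  apply: closed_openC; apply: closed_comp => [? _|]; first exact: Zx_continuous.
  by apply: accessible_closed_set1; exact: hausdorff_accessible.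
have [w|s sP] := base_nbhs_cofinite (Zspace_compact cX cY cphi)
    (@Zidx_open X Y M phi) oN.
  move=> /= w0; have [wx|wx] := pselect (Zx w = x); last by right.
  by left; rewrite -(Zbase_Zx y0 w0) wx.
exists s => w /sP[[Vw Uw]|//] _; split => //; exact: VP.
Qed.

(** The last hypothesis says that [U] meets the set [{b} * Y] of every fibre
    which has one.  If there were no limit, two sequences converging to [b] with
    separated values of [g] would form a set [S] with [b]; in a fibre over an
    index [m] with [phi m = S] that avoids countably many exceptions, [g] could
    not be continuous at a point of [U] over [b]. *)
Lemma Zspace_limit (U : set Z) (g : Z -> L) (b : X) : open U ->
  {within U, continuous g} -> closure (Zbase phi y0 @^-1` U) b ->
  (forall m, phi m b -> exists2 w : Z, U w & Zidx w = Some m /\ Zx w = b) ->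
  exists l : L, (g \o Zbase phi y0) @ within (Zbase phi y0 @^-1` U) (nbhs b) --> l.
Proof.
move=> oU cg; set U0 := Zbase phi y0 @^-1` U; set g0 := g \o Zbase phi y0.
move=> clb meet.
have cg0 : {within U0, continuous g0}.
  by apply: within_comp cg; exact: Zbase_continuous.
have [Ub|nUb] := pselect (U0 b).
  exists (g0 b); have /subspace_continuousP := cg0; exact.
have FF : ProperFilter (g0 @ within U0 (nbhs b)).
  by apply: fmap_proper_filter; exact: within_nbhs_proper.
have [l [_ ll]] := cL FF filterT.
exists l; apply: contrapT => nl.
have [d d0 nd] : exists2 d : R, 0 < d &
    ~ \forall x \near within U0 (nbhs b), mdist l (g0 x) < d.
  apply: contrapT => H; apply: nl; apply/cvgrPdist_lt => d d0.
  by apply: contrapT => H1; apply: H; exists d.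
(* [l] is a cluster value but not the limit; [d / 4] against [d] leaves room
   for four errors of [d / 8], two along each sequence. *)
pose A0 := [set x | U0 x /\ mdist l (g0 x) < d / 4].
pose A1 := [set x | U0 x /\ d <= mdist l (g0 x)].
have b0 : closure A0 b.
  move=> O bO.
  have lO : nbhs l [set z | mdist l z < d / 4].
    by apply/nbhs_mdistP; exists (d / 4) => //=; rewrite divr_gt0.
  have : (g0 @ within U0 (nbhs b)) [set z | exists2 x, g0 x = z & U0 x /\ O x].
    have : nbhs b (fun x => U0 x -> exists2 y, g0 y = g0 x & U0 y /\ O y).
      by apply: filterS bO => x Ox Ux; exists x.
    exact.
  move=> /ll/(_ lO)[_ [[x <- [Ux Ox]] lx]].
  by exists x.
have b1 : closure A1 b.
  move=> O bO; apply: contrapT => H; apply: nd.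
  have : nbhs b (fun x => U0 x -> mdist l (g0 x) < d).
    apply: filterS bO => x Ox Ux; rewrite ltNge; apply/negP => dx.
    by apply: H; exists x.
  exact.
have [u [Au ub]] := frX b0; have [v [Av vb]] := frX b1.
have un n : u n <> b by move=> e; apply: nUb; rewrite -e; have [] := Au n.
have vn n : v n <> b by move=> e; apply: nUb; rewrite -e; have [] := Av n.
have sS := cvg_sequences_seq_family hX ub vb un vn.
set S := _ `|` _ in sS.
have ncM : ~ countable [set: M].
  apply: (uncountable_above_weight (hausdorff_accessible hX)) weightX => bb.
  have [x [[Ux _] xb]] := b0 _ bb; apply: nUb.
  by rewrite -(xb : x = b).
have d8 : 0 < d / 8 by rewrite divr_gt0.
have /choice[su suP] n := Zspace_tube oU cg (Au n).1 d8.
have /choice[sv svP] n := Zspace_tube oU cg (Av n).1 d8.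
pose E := \bigcup_n ([set` su n] `|` [set` sv n]).
have cE : countable E.
  apply: bigcup_countable => // n _; apply: finite_set_countable.
  by rewrite finite_setU; split; exact: finite_seq.
(* [E] collects the countably many exceptional indices of the points of [S]
   other than [b]. *)
have [m phim mE] : exists2 m, phi m = S & ~ E m.
  apply: contrapT => H; apply: ncM.
  have sub : phi @^-1` [set S] `<=` E.
    by move=> m /= mS; apply: contrapT => mE; apply: H; exists m.
  rewrite /countable -(card_le_eql (many sS)).
  by apply: card_le_trans cE; exact: subset_card_le.
have bm : phi m b by rewrite phim; left.
have [w Uw [wm wb]] := meet m bm.
have [V [oV Vw VP]] := mdist_within cg Uw d8.
have um n : phi m (u n) by rewrite phim; right; left; exists n.
have vm n : phi m (v n) by rewrite phim; right; right; exists n.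
pose k (x : set_type (phi m)) : Z :=
  @Zpoint X Y M phi (Some m, set_val x, Zy y0 m w) (set_valP x).
have ck : continuous k.
  apply: (Zpoint_continuous (f := fun x : set_type (phi m) =>
     (Some m, set_val x, Zy y0 m w) : Aone M * X * Y)).
  have c1 : continuous (fun _ : set_type (phi m) => Some m : Aone M).
    exact: cst_continuous.
  have c2 : continuous (fun _ : set_type (phi m) => Zy y0 m w).
    exact: cst_continuous.
  exact: (continuous_pair (continuous_pair c1 (@initial_continuous _ _ _)) c2).
pose b' : set_type (phi m) := exist _ b (mem_set bm).
have kb : k b' = w.
  apply: (@Zspace_inj _ _ _ _ y0 m) => //; rewrite ?Zidx_point ?Zx_point//.
  by rewrite Zy_point.
have [V1 oV1 kV] : exists2 V1, open V1 & k @^-1` V = set_val @^-1` V1.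
  by apply: set_type_openP; move/continuousP : ck; apply.
have V1b : V1 b.
  have : (k @^-1` V) b' by rewrite /= kb.
  by rewrite kV.
have bV1 : nbhs b V1 by exact: open_nbhs_nbhs.
have kP (x : X) (xm : phi m x) (s : seq M) : V1 x -> U0 x -> m \notin s ->
    (forall w : Z, (forall m, m \in s -> Zidx w <> Some m) -> Zx w = x ->
      U w /\ mdist (g0 x) (g w) < d / 8) ->
    mdist (g0 x) (g w) < d / 8 + d / 8.
  move=> V1x Ux ms H; pose x' : set_type (phi m) := exist _ x (mem_set xm).
  have Vx : V (k x').
    have : (set_val @^-1` V1) x' by [].
    by rewrite -kV.
  have [|| Ukx gx] := H (k x').
  - by rewrite Zidx_point => m' m's [mm']; move: ms; rewrite mm' m's.
  - by rewrite Zx_point.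
  apply: le_lt_trans (metric_triangle _ (g (k x')) _) _.
  by rewrite ltrD// metric_sym; exact: VP.
have [n1 _ H1] := ub _ bV1; have [n2 _ H2] := vb _ bV1.
have h1 : mdist (g0 (u n1)) (g w) < d / 8 + d / 8.
  apply: (kP _ (um n1) (su n1)) => //; first exact: H1 n1 (leqnn _).
  - exact: (Au n1).1.
  - by apply/negP => ms; apply: mE; exists n1 => //; left.
  - by move=> w' /suP; exact.
have h2 : mdist (g0 (v n2)) (g w) < d / 8 + d / 8.
  apply: (kP _ (vm n2) (sv n2)) => //; first exact: H2 n2 (leqnn _).
  - exact: (Av n2).1.
  - by apply/negP => ms; apply: mE; exists n2 => //; right.
  - by move=> w' /svP; exact.
have [_ lu] := Au n1; have [_ lv] := Av n2.
have t1 := metric_triangle l (g0 (u n1)) (g0 (v n2)).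
have t2 := metric_triangle (g0 (u n1)) (g w) (g0 (v n2)).
rewrite (metric_sym (g0 (v n2))) in h2.
lra.
Qed.

(** The bound is stated for a closed set [K] all of whose points have only
    neighbourhoods of large L-Ind; it is used for the kernel K(X). *)
Lemma Zspace_not_LInd_le (J : Type) (h : J -> Ord) (K : set X) :
  closed K ->
  (forall b V j, K b -> nbhs b V -> ~ LInd_le L (h j) (set_type (closure V))) ->
  (forall j, ~ LInd_le L (h j) Y) ->
  ~ LInd_le L ozero (set_type K) ->
  ~ LInd_le L (osup h) Z.
Proof.
move=> cK hK hjY nK hZ.
have cphi m : closed (phi m) by exact: seq_family_closed.
have hdZ : hausdorff_space Z by exact: Zspace_hausdorff.
have cbase : continuous (Zbase phi y0) by exact: Zbase_continuous.
have ee : closed_embedding (Zbase phi y0).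
  apply: closed_embedding_compact => // x x' e.
  by rewrite -(Zx_base phi y0 x) e Zx_base.
have [F [f [cF FK cf nf]]] := LInd_not_zero l0 cK nK.
have [f' cf' f'P] := extend_along_within l0 ee cF cf.
have [_ _ fe] := ee.
have [U [oU FU [g [cg gf]] rU]] := hZ _ _ (fe _ cF) cf'.
have cU : closed (~` U) by exact: open_closedC.
pose U0 := Zbase phi y0 @^-1` U; pose g0 := g \o Zbase phi y0.
have oU0 : open U0 by move/continuousP : cbase; apply.
have cg0 : {within U0, continuous g0} by exact: within_comp cg.
have KU : K `<=` closure U0.
  move=> b Kb; apply: contrapT => nb.
  have oC : open (~` closure U0) by apply: closed_openC; exact: closed_closure.
  have bV : nbhs b (~` closure U0) by exact: open_nbhs_nbhs.
  have VU : closure (~` closure U0) `<=` ~` U0.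
    have cU0 : closed (~` U0) by exact: open_closedC.
    rewrite [X in _ `<=` X]((closure_id _).1 cU0); apply: closureS.
    by apply: subsetC; exact: subset_closure.
  case: rU => [U0'|[j hj]].
    have : (~` U) (Zbase phi y0 b) by apply: VU; exact: subset_closure.
    by rewrite U0'.
  apply: (hK b _ j Kb bV).
  have [|e' ee'] := @closed_embedding_restrict _ _ _ (closure (~` closure U0))
    (~` U) ee (@closed_closure _ _) _.
    by move=> x /VU.
  exact: (LInd_le_embedding l0 ee' hj).
have lim b : K b -> exists l : L, g0 @ within U0 (nbhs b) --> l.
  move=> Kb; apply: (Zspace_limit oU cg) => //; first exact: KU.
  move=> m bm; apply: contrapT => H.
  pose k (y : Y) : Z := @Zpoint X Y M phi (Some m, b, y) bm.
  have kU y : (~` U) (k y).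
    by move=> Uy; apply: H; exists (k y) => //; rewrite Zidx_point Zx_point.
  case: rU => [U0'|[j hj]]; first by have := kU y0; rewrite U0'.
  apply: (hjY j).
  have ck : continuous k.
    apply: (Zpoint_continuous (f := fun y => (Some m, b, y) : Aone M * X * Y)).
    have c1 : continuous (fun _ : Y => (Some m, b) : Aone M * X).
      exact: cst_continuous.
    by apply: (continuous_pair c1 (g := id)) => y; exact: cvg_id.
  pose k' (y : Y) : set_type (~` U) := exist _ (k y) (mem_set (kU y)).
  apply: (LInd_le_embedding l0 _ hj); apply: (@closed_embedding_compact _ _ k').
  - by [].
  - exact: hausdorff_set_type.
  - exact: continuous_to_set_type.
  - move=> y y' /(congr1 set_val) e.
    have /Zpoint_eqP[[//]|[]//] : k y = k y' := e.
have [kk ckk kkg] := extend_limits oU0 KU lim cg0.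
apply: (nf kk ckk) => x Fx; rewrite kkg//; last 2 first.
- exact: FK.
- by apply: FU; exists x.
by rewrite /g0 /= gf ?f'P//; exists x.
Qed.

End Lower.

(** * From the inequalities to the values of L-Ind *)

Section LIndValues.
Variable L : topologicalType.

Lemma dim_min_le (P : Ord -> Prop) (a : Ord) :
  (forall b c, ord_le b c -> P b -> P c) ->
  dim_le (dim_min P) (DimOrd a) <-> P a.
Proof.
move=> mP; rewrite /dim_min; case: pselect => [e|ne] /=.
  have [Pb leastb] := projT2 (cid (ord_least_ex e)).
  by split=> [ba|Pa]; [exact: mP ba Pb|exact: leastb].
by split => // Pa; apply: ne; exists a.
Qed.

Lemma LInd_leP (X : topologicalType) (a : Ord) :
  dim_le (LInd L X) (DimOrd a) <-> LInd_le L a X.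
Proof.
rewrite /LInd; case: pselect => [X0|nX] /=.
  split => // _; case: a => J h F f cF cf; exists setT; split => //.
  - exact: openT.
  - exists f; split => // x.
    by have : (@set0 X) x by rewrite -X0.
  - by left; rewrite setCT.
apply: dim_min_le => b c bc; exact: LInd_le_ord.
Qed.

Lemma LInd_at_leP (X : topologicalType) (b : X) (a : Ord) :
  dim_le (LInd_at L b) (DimOrd a) <->
  exists2 U, nbhs b U & LInd_le L a (set_type (closure U)).
Proof.
rewrite /LInd_at dim_min_le.
  by split=> [[U [bU /LInd_leP]]|[U bU /LInd_leP]]; exists U.
move=> c d cd [U [bU /LInd_leP Uc]]; exists U; split => //.
by apply/LInd_leP; exact: LInd_le_ord Uc.
Qed.

Lemma LInd_nonempty (X : topologicalType) : [set: X] !=set0 ->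
  LInd L X = DimInfty /\ (forall a, ~ LInd_le L a X) \/
  exists2 a, LInd L X = DimOrd a & ord_is_least (LInd_le L ^~ X) a.
Proof.
move=> [x _]; rewrite /LInd; case: pselect => [X0|nX] /=.
  by have : (@set0 X) x by rewrite -X0.
rewrite /dim_min; case: pselect => [e|ne]; [right|left].
  by exists (projT1 (cid (ord_least_ex e))) => //; case: cid.
by split => // a Xa; apply: ne; exists a.
Qed.

End LIndValues.

Lemma dim_le_trans (d e f : Dim) : dim_le d e -> dim_le e f -> dim_le d f.
Proof.
by case: d e f => [|a|] [|b|] [|c|] //=; exact: ord_le_trans.
Qed.

Lemma ord_is_least_not_lt (P : Ord -> Prop) (J : Type) (h : J -> Ord) (j : J) :
  ord_is_least P (osup h) -> ~ P (h j).
Proof.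
move=> [_ least] /least hj; apply: (@ord_lt_irrefl (h j)).
case E : (h j) hj => [I k] /= /(_ j)[i]; rewrite E => hi.
by exists i.
Qed.

(** The value -1 is the only one not determined by the ordinals above it: the
    ordinals bounding -1 and 0 are the same. *)
Lemma dim_le_ords (d e : Dim) : e <> DimN1 ->
  (forall a, dim_le e (DimOrd a) -> dim_le d (DimOrd a)) -> dim_le d e.
Proof.
case: e => [//|a|] _ H; last by case: d H.
by apply: H; exact: ord_le_refl.
Qed.

(** The inequality L-Ind_{b+} X <= L-Ind X always holds, by taking the whole
    space as the neighbourhood, so only the converse is expressed. *)
Lemma LInd_kernelP (L X : topologicalType) (l0 : L) (b : X) :
  LInd_kernel L X b <-> forall U a, nbhs b U ->
    LInd_le L a (set_type (closure U)) -> LInd_le L a X.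
Proof.
have X0 : LInd L X <> DimN1.
  have [|[-> _]//|[a -> _]//] := @LInd_nonempty L X; by exists b.
split=> [[_ H] U a bU Ua|H].
  apply/LInd_leP; apply: dim_le_trans H _.
  by apply/LInd_at_leP; exists U.
split; apply: dim_le_ords => //.
- move=> a /LInd_leP Xa; apply/LInd_at_leP; exists setT; first exact: filterT.
  by apply: LInd_le_closed Xa => //; exact: closed_closure.
- by rewrite /LInd_at /dim_min; case: pselect.
- by move=> a /LInd_at_leP[U bU Ua]; apply/LInd_leP; exact: H Ua.
Qed.

Lemma LInd_kernel_closed (L X : topologicalType) (l0 : L) :
  closed (LInd_kernel L X).
Proof.
move=> b clb; apply/(LInd_kernelP l0) => U a bU.
have [b' [Kb' Ub']] := clb _ (nbhs_interior bU).
exact: ((LInd_kernelP l0 b').1 Kb' U a Ub').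
Qed.

Theorem theorem4p4 (R : realType) (L : metricType R) (X Y : topologicalType)
    (M : choiceType) (phi : M -> set X) :
  [set: L] !=set0 -> compact [set: L] -> ANR R L -> ~ contractible R L ->
  tychonoff_space X -> compact [set: X] -> [set: X] !=set0 ->
  tychonoff_space Y -> compact [set: Y] -> [set: Y] !=set0 ->
  frechet_space X ->
  Z_data Y phi ->
  dim_eq (LInd L X) (LInd L Y) ->
  dim_le (DimOrd (osucc ozero)) (LInd L (set_type (LInd_kernel L X))) ->
  dim_eq (LInd L (Zspace Y phi)) (dim_succ (LInd L X)).
Proof.
move=> [l0 _] cL anrL _ tX cX X0 tY cY Y0 frX [_ weightX _ _ [sphi many]] XY hK.
have hX : hausdorff_space X := tychonoff_hausdorff R tX.
have hY : hausdorff_space Y := tychonoff_hausdorff R tY.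
have [x0 _] := X0; have [y0 _] := Y0.
have cphi m : closed (phi m) by exact: seq_family_closed.
have ZX a : LInd_le L a (Zspace Y phi) -> LInd_le L a X.
  apply: (@LInd_le_embedding L l0 a X _ (Zbase phi y0)).
  apply: closed_embedding_compact => //.
  - exact: Zspace_hausdorff.
  - exact: Zbase_continuous.
  - by move=> x x' e; rewrite -(Zx_base phi y0 x) e Zx_base.
have Z0 : [set: Zspace Y phi] !=set0 by exists (Zbase phi y0 x0).
have YX a : LInd_le L a Y <-> LInd_le L a X.
  by split=> /LInd_leP h; apply/LInd_leP; apply: dim_le_trans h; case: XY.
have nK : ~ LInd_le L ozero (set_type (LInd_kernel L X)).
  move=> /LInd_leP K0; have /= := dim_le_trans hK K0.
  by move=> /(_ tt)[[]].
have [[EX nX]|[c EX Xc]] := LInd_nonempty L X0.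
  rewrite EX /=; have [[-> _]//|[a _ [Za _]]] := LInd_nonempty L Z0.
  by case: (nX a); exact: ZX.
have Zc : LInd_le L (osucc c) (Zspace Y phi).
  have Xcc : LInd_le L c X by case: Xc.
  by apply: Zspace_LInd_le => //; exact/YX.
rewrite EX; split; first exact/LInd_leP.
have [[-> _]//|[z -> [Zz _]]] := LInd_nonempty L Z0.
rewrite /=; case: z Zz => J' h' Zz /= _; apply: contrapT => nlt.
have Zcc : LInd_le L c (Zspace Y phi).
  apply: LInd_le_ord Zz; apply: contrapT => /ord_ltNge; exact: nlt.
case: c EX Xc Zc Zcc nlt => J h EX Xc _ Zcc _.
apply: (@Zspace_not_LInd_le R L cL l0 X Y M phi hX hY cX cY sphi many weightX
  frX y0 J h (LInd_kernel L X)) => //.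
- exact: LInd_kernel_closed.
- move=> b V j /(LInd_kernelP l0) Kb bV /(Kb _ _ bV).
  exact: (ord_is_least_not_lt Xc).
- by move=> j /YX; exact: (ord_is_least_not_lt Xc).
Qed.
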